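(* Let $\mu:[0,1]^2\to\mathbb{R}$ be Riemann-integrable with $\mu>0$, and for $n\ge1$ let $A_n(\mu)$ be the velocity stiffness matrix with viscosity $\mu$ of the Taylor–Hood $\mathbb{P}_2$-$\mathbb{P}_1$ discretization on the uniform mesh $\Omega_n$ of $(0,1)^2$, in which $\mu$ is replaced within each element by its midpoint value (as defined in the context); $A_n(1)$ is the same matrix for the constant viscosity $1$. For fixed $n$, $\mu\mapsto A_n(\mu)$ is a matrix-valued linear positive operator, and it satisfies the monotonicity property $$A_n(\mu)\le A_n(\hat\mu)\quad\text{for every }\hat\mu\ge\mu,$$ where the inequality between matrices is in the sense of the partial ordering of Hermitian matrices. Consequently, with eigenvalues arranged in the same monotone order, for every $n$ and every $j$, $$\lambda_j(A_n(\operatorname{ess\,inf}\mu))=(\operatorname{ess\,inf}\mu)\,\lambda_j(A_n(1))\;\le\;\lambda_j(A_n(\mu))\;\le\;\lambda_j(A_n(\operatorname{ess\,sup}\mu))=(\operatorname{ess\,sup}\mu)\,\lambda_j(A_n(1)).$$ Moreover, let $h_3(\theta_1,\theta_2)=\frac16(1+e^{i\theta_1})(1+e^{i\theta_2})$, let $$\hat G(\theta_1,\theta_2)=\begin{bmatrix} \frac{16}{3} & 0 & -\frac43 & -\frac43 e^{i\theta_2} & 0 & 0 & -\frac43 e^{i\theta_1} & -\frac43 e^{i(\theta_2+\theta_1)}\\ 0 & \frac{16}{3} & -\frac43 & -\frac43 & 0 & 0 & -\frac43 e^{i\theta_1} & -\frac43 e^{i\theta_1}\\ -\frac43 & -\frac43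 & 4 & 0 & -\frac43 & -\frac43 e^{i\theta_2} & 0 & 2h_3\\ -\frac43 e^{-i\theta_2} & -\frac43 & 0 & \frac{16}{3} & -\frac43 & -\frac43 & 0 & 0\\ 0 & 0 & -\frac43 & -\frac43 & \frac{16}{3} & 0 & -\frac43 & -\frac43\\ 0 & 0 & -\frac43 e^{-i\theta_2} & -\frac43 & 0 & \frac{16}{3} & -\frac43 e^{-i\theta_2} & -\frac43\\ -\frac43 e^{-i\theta_1} & -\frac43 e^{-i\theta_1} & 0 & 0 & -\frac43 & -\frac43 e^{i\theta_2} & \frac{16}{3} & 0\\ -\frac43 e^{-i(\theta_2+\theta_1)} & -\frac43 e^{-i\theta_1} & 2\overline{h_3} & 0 & -\frac43 & -\frac43 & 0 & 4 \end{bmatrix},$$ and let $m=\min_{\theta\in[-\pi,\pi]^2}\lambda_{\min}(\hat G(\theta))$ and $M=\max_{\theta\in[-\pi,\pi]^2}\lambda_{\max}(\hat G(\theta))$. Then for every $n$ and every $j$, the eigenvalues of the diagonal block $A_{x,n}(\mu)$ of $A_n(\mu)$ satisfy $$\lambda_j(A_{x,n}(\mu))\in\bigl(m\,\operatorname{ess\,inf}\mu,\;M\,\operatorname{ess\,sup}\mu\bigr),$$ hence no eigenvalue can emerge as an outlier beyond the essential range of the symbol $\mu(x,y)\,\hat G(\theta_1,\theta_2)$.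
   Context: Mesh: for each $n\ge1$, $\Omega_n$ is the triangulation of $(0,1)^2$ obtained by dividing the square into $n\times n$ equal square cells of side $1/n$ and cutting each cell by its two diagonals into four right isosceles triangles. Matrix: let $\{\phi_i\}$ be the standard nodal (Lagrange) basis of continuous functions on $[0,1]^2$ that are polynomials of degree at most $2$ on each triangle of $\Omega_n$ and vanish on the boundary (nodes: interior vertices and interior edge midpoints; there are $8n^2-4n+1$ of them). For each triangle $K$ of $\Omega_n$ let $\mu_K$ be the value of $\mu$ at the midpoint (barycenter) of $K$. Then $$A_n(\mu)=\begin{bmatrix}A_{x,n}(\mu)&0\\0&A_{x,n}(\mu)\end{bmatrix},\qquad (A_{x,n}(\mu))_{ij}=\sum_{K\in\Omega_n}\mu_K\int_K\nabla\phi_j\cdot\nabla\phi_i .$$ This discretizes the operator $-\nabla\cdot(\mu\nabla\,\cdot\,)$ acting on each of the two velocity components with homogeneous Dirichlet boundary conditions, the integrals $\int\mu\,\nabla\phi_j\cdot\nabla\phi_i$ being evaluated with $\mu$ approximated within each element by its midpoint value. A matrix-valued linear positive operator is a linear map from functions to matrices that sends nonnegative functions to Hermitian positive semidefinite matrices.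
   Formalization: The eigenvalue bounds by ess inf μ and ess sup μ, and the localization, are proved assuming that ess inf μ ≤ μ_K ≤ ess sup μ at each element midpoint where μ is discontinuous; without this they fail (μ = 1 except a huge value at one midpoint). *)

(* Defs.v *)
From HB Require Import structures.
From mathcomp Require Import all_boot all_order all_algebra.
From mathcomp Require Import sesquilinear spectral complex.
From mathcomp Require Import all_classical all_reals all_analysis.
From mathcomp Require Import ess_sup_inf.

Set Implicit Arguments.
Unset Strict Implicit.
Unset Printing Implicit Defensive.

Import Order.TTheory GRing.Theory Num.Theory.
Import numFieldNormedType.Exports.

Local Open Scope classical_set_scope.
Local Open Scope ring_scope.
Local Open Scope sesquilinear_scope.

(** * Hermitian matrices *)

Section Matrices.
Context {R : realType}.
Local Notation C := R[i].

(* The order on [C] makes [0 <= z] mean: [z] is real and nonnegative. *)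
Definition hpsd {N} (A : 'M[C]_N) : Prop :=
  A \is hermsymmx /\ forall v : 'cV[C]_N, 0 <= (v^t* *m A *m v) 0 0.

Definition loewner_le {N} (A B : 'M[C]_N) : Prop := hpsd (B - A).

(* Roots of the characteristic polynomial, counted with multiplicity and
   sorted in nonincreasing order. Only used for Hermitian matrices, all of
   whose roots are real, so that taking real parts loses nothing. *)
Definition eigenvalues {N} (A : 'M[C]_N) : seq R :=
  sort >=%R [seq complex.Re z | z <- sval (closed_field_poly_normal (char_poly A))].

Definition lambda {N} (A : 'M[C]_N) (j : nat) : R := nth 0 (eigenvalues A) j.
Definition lambda_max {N} (A : 'M[C]_N) : R := lambda A 0.
Definition lambda_min {N} (A : 'M[C]_N) : R := lambda A N.-1.

Definition complexify {N} (A : 'M[R]_N) : 'M[C]_N := map_mx (real_complex R) A.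

End Matrices.

(** * Functions on the unit square *)

Section Square.
Context {R : realType}.

Definition square : set (R * R) := `[0, 1] `*` `[0, 1].
Definition open_square : set (R * R) := `]0, 1[ `*` `]0, 1[.

Lemma measurable_square : measurable square.
Proof. by apply: measurableX; exact: measurable_itv. Qed.

Definition leb2 := (@lebesgue_measure R \x @lebesgue_measure R)%E.

(* Darboux sums over the rectangles of the grid 0 :: s, 0 :: t. The value
   [phi (f @` rectangle)] is a supremum or an infimum. *)
Definition darboux_sum (phi : set R -> R) (f : R * R -> R) (s t : seq R) : R :=
  \sum_(i < size s) \sum_(j < size t)
    (let: x0 := nth 0 (0 :: s) i in let: x1 := nth 0 s i in
     let: y0 := nth 0 (0 :: t) j in let: y1 := nth 0 t j in
     phi (f @` (`[x0, x1] `*` `[y0, y1])) * ((x1 - x0) * (y1 - y0))).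

Definition darboux_sums (phi : set R -> R) (f : R * R -> R) : set R :=
  [set S | exists s t, [/\ itv_partition 0 1 s, itv_partition 0 1 t
                         & S = darboux_sum phi f s t]].

Definition lower_integral f : R := sup (darboux_sums inf f).
Definition upper_integral f : R := inf (darboux_sums sup f).

Definition riemann_integrable (f : R * R -> R) : Prop :=
  (exists B, forall p, square p -> `|f p| <= B) /\
  lower_integral f = upper_integral f.

(* [fine] is harmless for functions that are bounded on the square, in
   particular for Riemann-integrable ones: both extended reals are then
   finite. *)
Definition essinf (f : R * R -> R) : R :=
  fine (ess_inf (mrestr leb2 measurable_square) (EFin \o f)).
Definition esssup (f : R * R -> R) : R :=
  fine (ess_sup (mrestr leb2 measurable_square) (EFin \o f)).

(* A linear map from functions on the square to matrices that sends
   nonnegative functions to Hermitian positive semidefinite matrices. *)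
Definition linear_positive_operator {N} (T : (R * R -> R) -> 'M[R[i]]_N) : Prop :=
  (forall (a : R) f g,
     T (fun p => a * f p + g p) = (real_complex R a) *: T f + T g) /\
  (forall f, (forall p, square p -> 0 <= f p) -> hpsd (T f)).

End Square.

(** * Mesh, quadratic elements and stiffness matrices *)

Section FiniteElements.
Context {R : realType}.
Implicit Type n : nat.

(* [(i, j, k)] is the triangle of the cell [i/n, (i+1)/n] x [j/n, (j+1)/n]
   having as vertices the centre of the cell and its corners number k and
   k + 1 modulo 4, the corners being numbered counterclockwise from the lower
   left one. *)
Definition triangle n : finType := ('I_n * 'I_n * 'I_4)%type.

Definition corner n (i j k : nat) : R * R :=
  let: (a, b) := nth (0, 0)%N [:: (0, 0); (1, 0); (1, 1); (0, 1)]%N (k %% 4) in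
  ((i + a)%:R / n%:R, (j + b)%:R / n%:R).

Definition cell_center n (i j : nat) : R * R :=
  ((i%:R + 2^-1) / n%:R, (j%:R + 2^-1) / n%:R).

Definition vertex n (K : triangle n) (a : 'I_3) : R * R :=
  let: (i, j, k) := K in
  nth (0, 0) [:: cell_center n i j; corner n i j k; corner n i j k.+1] a.

Definition region n (K : triangle n) : set (R * R) :=
  [set p | exists t : 'I_3 -> R,
     [/\ forall a, 0 <= t a, \sum_a t a = 1
       & p = (\sum_a t a * (vertex K a).1, \sum_a t a * (vertex K a).2)]].

Definition barycenter n (K : triangle n) : R * R :=
  ((\sum_a (vertex K a).1) / 3, (\sum_a (vertex K a).2) / 3).

Definition edge_midpoint n (K : triangle n) (a b : 'I_3) : R * R :=
  (((vertex K a).1 + (vertex K b).1) / 2, ((vertex K a).2 + (vertex K b).2) / 2).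

(* With [a = b] this is a vertex, otherwise the midpoint of an edge. *)
Definition interior_nodes n : set (R * R) :=
  open_square `&` [set p | exists (K : triangle n) a b, p = edge_midpoint K a b].

Definition quadratic_on (D : set (R * R)) (f : R * R -> R) : Prop :=
  exists c0 c1 c2 c3 c4 c5 : R, forall p, D p ->
    f p = c0 + c1 * p.1 + c2 * p.2
        + c3 * p.1 ^+ 2 + c4 * (p.1 * p.2) + c5 * p.2 ^+ 2.

Definition P2_space n (f : R * R -> R) : Prop :=
  [/\ {within square, continuous f},
      forall K : triangle n, quadratic_on (region K) f
    & forall p, square p -> ~ open_square p -> f p = 0].

Definition ndof n : nat := (8 * n ^ 2 - 4 * n + 1)%N.

(* [phi] is the nodal basis, for some numbering of the nodes. *)
Definition nodal_basis n (phi : 'I_(ndof n) -> R * R -> R) : Prop :=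
  exists node : 'I_(ndof n) -> R * R,
    [/\ injective node, range node = interior_nodes n,
        forall i, P2_space n (phi i)
      & forall i j, phi i (node j) = (i == j)%:R].

Definition partial1 (f : R * R -> R) (p : R * R) : R :=
  derive1 (fun x : R => f (x, p.2)) p.1.
Definition partial2 (f : R * R -> R) (p : R * R) : R :=
  derive1 (fun y : R => f (p.1, y)) p.2.

(* The integral is over the open triangle, which differs from the closed one
   by a null set: the partial derivatives of the basis functions may fail to
   exist on the edges of the mesh. *)
Definition Ax n (phi : 'I_(ndof n) -> R * R -> R) (mu : R * R -> R) :
    'M[R[i]]_(ndof n) :=
  complexify (\matrix_(i, j) \sum_(K : triangle n)
    mu (barycenter K) *
      \int[leb2]_(p in (region K)^°)
        (partial1 (phi j) p * partial1 (phi i) p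
         + partial2 (phi j) p * partial2 (phi i) p)).

Definition A n (phi : 'I_(ndof n) -> R * R -> R) (mu : R * R -> R) :
    'M[R[i]]_(ndof n + ndof n) :=
  block_mx (Ax phi mu) 0 0 (Ax phi mu).

(* Changing [mu] at a single barycenter changes the matrices but neither the
   Riemann integrability nor the essential bounds of [mu], so bounding the
   former by the latter requires the following. It holds in particular if
   [mu] is continuous at all barycenters, or if
   [essinf mu <= mu <= esssup mu] everywhere on the square. *)
Definition midpoint_values_essential n (mu : R * R -> R) : Prop :=
  forall K : triangle n, ~ {for barycenter K, continuous mu} ->
    essinf mu <= mu (barycenter K) <= esssup mu.

End FiniteElements.

(** * Symbol *)

Section Symbol.
Context {R : realType}.
Local Notation C := R[i].

Definition expi (t : R) : C := Complex (cos t) (sin t).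

Definition h3 (t : R * R) : C := 6^-1 * (1 + expi t.1) * (1 + expi t.2).

Definition Ghat (t : R * R) : 'M[C]_8 :=
  let e1 := expi t.1 in let e2 := expi t.2 in let e21 := expi (t.2 + t.1) in
  let f1 := expi (- t.1) in let f2 := expi (- t.2) in
  let f21 := expi (- (t.2 + t.1)) in
  let d := 16 / 3 : C in let b := - (4 / 3) : C in
  \matrix_(i, j) nth 0 (nth [::]
    [:: [:: d      ; 0     ; b     ; b * e2; 0; 0     ; b * e1; b * e21  ];
        [:: 0      ; d     ; b     ; b     ; 0; 0     ; b * e1; b * e1   ];
        [:: b      ; b     ; 4     ; 0     ; b; b * e2; 0     ; 2 * h3 t ];
        [:: b * f2 ; b     ; 0     ; d     ; b; b     ; 0     ; 0        ];
        [:: 0      ; 0     ; b     ; b     ; d; 0     ; b     ; b        ];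
        [:: 0      ; 0     ; b * f2; b     ; 0; d     ; b * f2; b        ];
        [:: b * f1 ; b * f1; 0     ; 0     ; b; b * e2; d     ; 0        ];
        [:: b * f21; b * f1; 2 * (h3 t)^*; 0 ; b; b   ; 0     ; 4        ]]
    i) j.

Definition frequencies : set (R * R) := `[- pi, pi] `*` `[- pi, pi].

Definition is_min (S : set R) (m : R) : Prop := S m /\ lbound S m.
Definition is_max (S : set R) (M : R) : Prop := S M /\ ubound S M.

(* The symbol [mu(x, y) Ghat(theta1, theta2)], a function on
   [square `*` frequencies]. *)
Definition symbol (mu : R * R -> R) (z : (R * R) * (R * R)) : 'M[C]_8 :=
  (real_complex R (mu z.1)) *: Ghat z.2.

(* The essential range of a Hermitian matrix-valued function is the union of
   the essential ranges of its eigenvalue functions. Not being negligible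
   means having positive (outer) measure. *)
Definition essential_range {N} (D : set ((R * R) * (R * R)))
    (F : (R * R) * (R * R) -> 'M[C]_N) : set R :=
  [set y | exists k : 'I_N, forall eps : R, 0 < eps ->
     ~ (leb2 \x leb2)%E.-negligible
         (D `&` [set z | `|lambda (F z) k - y| < eps])].

End Symbol.

(* Main.v *)
Require Import Defs.
From HB Require Import structures.
From mathcomp Require Import all_boot all_order all_algebra.
From mathcomp Require Import perm sesquilinear spectral complex.
From mathcomp Require Import ring lra zify.
From mathcomp Require Import all_classical all_reals all_analysis.
From mathcomp Require Import ess_sup_inf measurable_realfun.
Set Implicit Arguments.
Unset Strict Implicit.
Unset Printing Implicit Defensive.
Import Order.TTheory GRing.Theory Num.Theory.
Import numFieldNormedType.Exports.
Local Open Scope classical_set_scope.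
Local Open Scope ring_scope.
Local Open Scope sesquilinear_scope.

(** Everything is decided element by element.  For a function [u] that is
    quadratic on a triangle [K], the integral of [|grad u|^2] over [K] is a sum
    of squares of linear forms in the six nodal values of [u]
    ([element_energy], [local_stiffness]); it does not depend on the mesh
    width.  Hence the Hermitian form of [A_x(mu)] at the coefficient vector of
    [u] is the sum over the triangles of [mu] at the barycentre times the
    energy of [u] on the triangle ([hform_Ax]).  Linearity, positivity and
    monotonicity in [mu] can be read off this formula.  Monotonicity of the
    forms passes to the ordered eigenvalues by intersecting spans of
    eigenvectors ([le_lambda]), and the barycentric values of [mu] lie between
    its essential bounds: by hypothesis where [mu] is discontinuous, and
    because neighbourhoods have positive measure elsewhere.

    The symbol is the same sum for one cell of the periodic mesh: its Hermitian
    form is the energy of the four triangles of a cell, nodes of neighbouring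
    cells being multiplied by phases ([symbol_energyE]).  Both extremal
    eigenvalues are explicit, [m = 0] and [M = 32/3].  The lower bound is
    positivity of the energy.  The upper bound comes from the identity
    [energy + gap = mass] on each triangle ([element_energyD_gap]), where [gap]
    is another sum of squares and [mass] distributes [32/3 |u|^2] at a node
    over the triangles around it.  At frequency 0 the constant mode attains 0,
    and the mode whose sign at the midpoints of the half-diagonals is opposite
    to its sign at the other nodes attains [32/3].

    The same identity bounds the stiffness matrix ([sum_mass_le]), and here the
    inequalities are strict: if the energy or the gap vanishes on every
    triangle, the value at the centre of a cell propagates to the next cell,
    and the boundary condition forces all nodal values to be zero
    ([nodal_values_eq0]).  So the eigenvalues of [A_x(mu)] lie strictly between
    [0] and [32/3 esssup mu].

    Both of these numbers are in the essential range of the symbol.  Near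
    frequency 0 the extremal eigenvalues of the symbol are controlled by
    Rayleigh quotients of the two modes above, which are trigonometric
    polynomials, and the set where [mu] is close to its essential supremum has
    positive outer measure; the product of such a set with a neighbourhood of
    frequency 0 is not negligible ([setX_not_negligible]). *)

(** * Eigenvalues of Hermitian matrices *)

Section HermitianEigenvalues.
Context {R : realType}.
Local Notation C := R[i].
Local Notation "x %:C" := (real_complex R x).

Definition hform {N} (A : 'M[C]_N) (v : 'cV[C]_N) : C := (v^t* *m A *m v) 0 0.

Definition sqnorm {N} (v : 'cV[C]_N) : C := (v^t* *m v) 0 0.

Lemma hformE N (A : 'M[C]_N) v :
  hform A v = \sum_i \sum_j (v i 0)^* * A i j * v j 0.
Proof.
rewrite /hform mxE exchange_big; apply: eq_bigr => j _.
by rewrite mxE mulr_suml; apply: eq_bigr => i _; rewrite !mxE.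
Qed.

Lemma sqnormE N (v : 'cV[C]_N) : sqnorm v = \sum_i (v i 0)^* * v i 0.
Proof. by rewrite /sqnorm mxE; apply: eq_bigr => i _; rewrite !mxE. Qed.

Lemma sqnorm_gt0 N (v : 'cV[C]_N) : v != 0 -> 0 < sqnorm v.
Proof.
move=> /eqP v0; rewrite sqnormE lt_neqAle eq_sym; apply/andP; split; last first.
  by apply: sumr_ge0 => i _; rewrite mulrC mul_conjC_ge0.
apply/negP => /eqP s0; apply: v0; apply/matrixP => i j; rewrite ord1 mxE.
have /psumr_eq0P H : forall i, true -> 0 <= (v i 0)^* * v i 0.
  by move=> k _; rewrite mulrC mul_conjC_ge0.
by have := H s0 i isT => /eqP; rewrite mulrC mul_conjC_eq0 => /eqP.
Qed.

Lemma sqnorm_unitary N (P : 'M[C]_N) v :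
  P \is unitarymx -> sqnorm (P *m v) = sqnorm v.
Proof.
move=> /unitarymxP/mulmx1C Pu.
by rewrite /sqnorm trmx_mul map_mxM /= mulmxA -[_ *m P]mulmxA Pu mulmx1.
Qed.

Lemma hform_diag N (A P : 'M[C]_N) (d : 'I_N -> R) v :
  A = P^t* *m diag_mx (\row_j (d j)%:C) *m P ->
  hform A v = \sum_j (d j)%:C * (((P *m v) j 0)^* * (P *m v) j 0).
Proof.
move=> ->; rewrite /hform !mulmxA -[_ *m P *m v]mulmxA -map_mxM -trmx_mul.
rewrite mxE; apply: eq_bigr => j _; rewrite mul_mx_diag !mxE.
by rewrite mulrAC [LHS]mulrC.
Qed.

Lemma char_poly_similar N (A P D : 'M[C]_N) :
  P \in unitmx -> A = invmx P *m D *m P -> char_poly A = char_poly D.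
Proof.
move=> Pu ->; rewrite /char_poly.
have pE : char_poly_mx (invmx P *m D *m P) =
    map_mx polyC (invmx P) *m char_poly_mx D *m map_mx polyC P.
  rewrite /char_poly_mx mulmxBr mulmxBl !map_mxM; congr (_ - _).
  by rewrite scalar_mxC -mulmxA -map_mxM mulVmx // map_mx1 mulmx1.
rewrite pE !det_mulmx mulrC mulrA -det_mulmx -map_mxM mulmxV //.
by rewrite map_mx1 det1 mul1r.
Qed.

Lemma eigenvalues_diag N (A P : 'M[C]_N) (d : 'I_N -> R) :
  P \is unitarymx -> A = P^t* *m diag_mx (\row_j (d j)%:C) *m P ->
  eigenvalues A = sort >=%R [seq d j | j <- enum 'I_N].
Proof.
move=> Pu AE; rewrite /eigenvalues; case: closed_field_poly_normal => r /= rE.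
apply/perm_sortP; [exact: ge_total|exact: ge_trans|exact: ge_anti|].
have -> : [seq d j | j <- enum 'I_N] =
    [seq complex.Re z | z <- [seq (d j)%:C | j <- enum 'I_N]].
  by rewrite -map_comp; apply: eq_map.
apply/perm_map/prod_XsubC_eq.
have := rE; rewrite (monicP (char_poly_monic A)) scale1r => <-.
rewrite (@char_poly_similar _ A P (diag_mx (\row_j (d j)%:C))) ?unitarymx_unit //.
  rewrite char_poly_trig ?diag_mx_is_trig // big_map big_enum.
  by apply: eq_bigr => i _; rewrite !mxE eqxx mulr1n.
by rewrite invmx_unitary.
Qed.

Lemma lambda_diag N (A P : 'M[C]_N) (d : 'I_N -> R) :
  P \is unitarymx -> A = P^t* *m diag_mx (\row_j (d j)%:C) *m P ->
  (forall i j : 'I_N, (i <= j)%N -> d j <= d i) ->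
  forall j : 'I_N, lambda A j = d j.
Proof.
move=> Pu AE dmono j; rewrite /lambda (eigenvalues_diag Pu AE) sorted_sort.
- by rewrite (nth_map j) ?size_enum_ord ?nth_ord_enum.
- exact: ge_trans.
rewrite sorted_map; apply: (@sub_sorted _ (relpre val leq)).
  by move=> x y /=; exact: dmono.
by rewrite -sorted_map val_enum_ord iota_sorted.
Qed.

(** The spectral theorem diagonalizes [A] with the eigenvalues in some order;
    permuting the eigenvectors puts them in the order of [lambda]. *)
Lemma hermitian_spectral N (A : 'M[C]_N) : A \is hermsymmx ->
  exists2 P : 'M[C]_N, P \is unitarymx &
    A = P^t* *m diag_mx (\row_j (lambda A j)%:C) *m P.
Proof.
move=> Ah; have An := hermitian_normalmx Ah.
have Pu := spectral_unitarymx A; have /orthomx_spectralP := An.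
have /mxOverP Dr := hermitian_spectral_diag_real Ah.
move: Pu Dr; set P := spectralmx A; set D := spectral_diag A => Pu Dr AE.
pose d j := complex.Re (D 0 j).
have DE : D = \row_j (d j)%:C.
  by apply/rowP => j; rewrite mxE RRe_real // Dr.
rewrite invmx_unitary // DE in AE.
have eE := eigenvalues_diag Pu AE.
pose t := [tuple d j | j < N].
have /tuple_permP [s sE] : perm_eq (eigenvalues A) t.
  by rewrite eE perm_sort perm_refl.
have lE (j : 'I_N) : lambda A j = d (s j).
  by rewrite /lambda sE -tnth_nth !tnth_mktuple.
exists (row_perm s P).
  apply/unitarymxP/matrixP => i j; rewrite mxE.
  have /unitarymxP/matrixP /(_ (s i) (s j)) := Pu; rewrite !mxE (inj_eq perm_inj).
  by move=> <-; apply: eq_bigr => k _; rewrite !mxE.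
rewrite {1}AE; apply/matrixP => i j; rewrite !mxE.
rewrite [LHS](reindex_inj (@perm_inj _ s)) /=; apply: eq_bigr => k _.
by rewrite !mul_mx_diag !mxE lE.
Qed.

Lemma size_eigenvalues N (A : 'M[C]_N) : size (eigenvalues A) = N.
Proof.
rewrite size_sort size_map; case: closed_field_poly_normal => r /= rE.
have := size_char_poly A; rewrite rE (monicP (char_poly_monic A)) scale1r.
by rewrite size_prod_XsubC => -[].
Qed.

Lemma lambda_le N (A : 'M[C]_N) (i j : nat) :
  (i <= j < N)%N -> lambda A j <= lambda A i.
Proof.
move=> /andP[ij jN]; have Es : sorted >=%R (eigenvalues A).
  by apply: sort_sorted; exact: ge_total.
apply: (sorted_leq_nth ge_trans ge_refl 0 Es) => //; rewrite inE size_eigenvalues //.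
exact: leq_ltn_trans jN.
Qed.

Lemma lambda_eigenvector N (A : 'M[C]_N) (j : 'I_N) : A \is hermsymmx ->
  exists2 v : 'cV[C]_N, v != 0 & A *m v = (lambda A j)%:C *: v.
Proof.
move=> /hermitian_spectral[P Pu AE]; exists (P^t* *m delta_mx j 0).
  apply: contraTneq (ltr01 : (0 : R) < 1) => /(congr1 (mulmx P)).
  rewrite mulmxA mulmx0 (unitarymxP Pu) mul1mx => /matrixP /(_ j 0).
  by rewrite !mxE !eqxx => /eqP; rewrite oner_eq0.
rewrite {1}AE -!mulmxA [P *m _]mulmxA (unitarymxP Pu) mul1mx scalemxAr.
congr (_ *m _); apply/matrixP => i k; rewrite mul_diag_mx !mxE.
by case: eqP => [->|] //=; rewrite !mulr0.
Qed.

Lemma hform_eigen N (A : 'M[C]_N) v (l : C) :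
  A *m v = l *: v -> hform A v = l * sqnorm v.
Proof. by move=> Av; rewrite /hform -mulmxA Av -scalemxAr mxE. Qed.

(** The span of the first [j + 1] eigenvectors of [A] meets the span of the
    eigenvectors of [B] from number [j] on, the dimensions adding up to
    [N + 1].  At a common vector the form of [A] is at least [lambda A j] and
    the form of [B] at most [lambda B j]. *)
Lemma le_lambda N (A B : 'M[C]_N) (j : 'I_N) :
  A \is hermsymmx -> B \is hermsymmx ->
  (forall v, hform A v <= hform B v) -> lambda A j <= lambda B j.
Proof.
move=> /hermitian_spectral[P Pu AE] /hermitian_spectral[Q Qu BE] AB.
(* The rows of M are the conditions on w to be in both spans; row j is zero,
   so M is singular. *)
pose M : 'M[C]_N := \matrix_(i, k)
  if (i < j)%N then Q i k else if (j < i)%N then P i k else 0.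
have /det0P[u u0 uM] : \det M^T == 0.
  rewrite det_tr (expand_det_row _ j) big1 // => k _.
  by rewrite mxE ltnn mul0r.
pose w := u^T; have w0 : w != 0 by rewrite trmx_eq0.
have Mw i : (M *m w) i 0 = 0.
  by have := congr1 (fun z => z^T i 0) uM; rewrite trmx_mul trmxK !mxE.
have Qw (i : 'I_N) : (i < j)%N -> (Q *m w) i 0 = 0.
  by move=> ij; rewrite -[RHS](Mw i) !mxE; apply: eq_bigr => k _; rewrite !mxE ij.
have Pw (i : 'I_N) : (j < i)%N -> (P *m w) i 0 = 0.
  move=> ij; rewrite -[RHS](Mw i) !mxE; apply: eq_bigr => k _.
  by rewrite !mxE ij ltnNge (ltnW ij).
have sge0 (z : C) : 0 <= z^* * z by rewrite mulrC mul_conjC_ge0.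
have Aw : (lambda A j)%:C * sqnorm w <= hform A w.
  rewrite (hform_diag _ AE) -(sqnorm_unitary w Pu) sqnormE mulr_sumr.
  apply: ler_sum => i _; case: (ltnP j i) => [/Pw->|ij]; first by rewrite !mulr0.
  by rewrite ler_wpM2r // lecR lambda_le // ij /=.
have Bw : hform B w <= (lambda B j)%:C * sqnorm w.
  rewrite (hform_diag _ BE) -(sqnorm_unitary w Qu) sqnormE mulr_sumr.
  apply: ler_sum => i _; case: (ltnP i j) => [/Qw->|ij]; first by rewrite !mulr0.
  by rewrite ler_wpM2r // lecR lambda_le // ij /=.
have := le_trans Aw (le_trans (AB w) Bw).
by rewrite ler_pM2r ?sqnorm_gt0 // lecR.
Qed.

Lemma lambdaZ N (A : 'M[C]_N) (c : R) (j : 'I_N) : A \is hermsymmx -> 0 <= c ->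
  lambda (c%:C *: A) j = c * lambda A j.
Proof.
move=> /hermitian_spectral[P Pu AE] c0.
apply: (@lambda_diag _ _ P (fun j => c * lambda A j) Pu) => [|i k ik].
  rewrite {1}AE scalemxAl scalemxAr; congr (_ *m _ *m _).
  apply/matrixP => i k; rewrite !mxE; case: eqP => _; last by rewrite mulr0.
  by rewrite !mulr1n rmorphM.
by rewrite ler_wpM2l // lambda_le // ik /=.
Qed.

Lemma hform_le_lambda_max N (A : 'M[C]_N) v : A \is hermsymmx ->
  hform A v <= (lambda_max A)%:C * sqnorm v.
Proof.
move=> /hermitian_spectral[P Pu AE].
rewrite (hform_diag _ AE) -(sqnorm_unitary v Pu) sqnormE mulr_sumr.
apply: ler_sum => i _; rewrite ler_wpM2r ?lecR ?lambda_le //=.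
by rewrite mulrC mul_conjC_ge0.
Qed.

Lemma lambda_min_le_hform N (A : 'M[C]_N) v : A \is hermsymmx ->
  (lambda_min A)%:C * sqnorm v <= hform A v.
Proof.
move=> /hermitian_spectral[P Pu AE].
rewrite (hform_diag _ AE) -(sqnorm_unitary v Pu) sqnormE mulr_sumr.
apply: ler_sum => i _; rewrite ler_wpM2r ?lecR ?lambda_le //=.
  by rewrite mulrC mul_conjC_ge0.
by case: N A i {v P Pu AE} => [|N] A [i iN] //=; rewrite -ltnS iN /=.
Qed.

Lemma lambda_bounds N (A : 'M[C]_N) (j : 'I_N) (a b : C) : A \is hermsymmx ->
  (forall v, a * sqnorm v <= hform A v <= b * sqnorm v) ->
  a <= (lambda A j)%:C <= b.
Proof.
move=> Ah Aab; have [v v0 Av] := lambda_eigenvector j Ah.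
by have := Aab v; rewrite (hform_eigen Av) !ler_pM2r ?sqnorm_gt0.
Qed.

End HermitianEigenvalues.

(** * The energy of a quadratic function on one triangle *)

Section ElementForms.
Context {F : numFieldType} (sigma : {rmorphism F -> F}).
Local Notation s x := (sigma x * x).

(** The integral of [|grad u|^2] for the values [c] at the centre of the cell,
    [a] and [b] at the two corners, and [p], [q], [r] at the midpoints of the
    edges [ca], [cb], [ab]; [sigma x * x] stands for [|x|^2].  The derivative
    along the leg [ca] is affine, so that the integral of its square is a third
    of the area times the sum of its squares at the edge midpoints; there it is
    proportional to [a - c] and [2 (r - q) +- (a + c - 2 p)]. *)
Definition element_energy (c a b p q r : F) : F :=
  (s (a - c) + 2 * s (a + c - 2 * p) + 8 * s (r - q)) / 6 +
  (s (b - c) + 2 * s (b + c - 2 * q) + 8 * s (r - p)) / 6.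

(** The part of [32/3 |u|^2] carried by one triangle, when the value at a node
    is shared equally: a centre belongs to 4 triangles, an interior corner to
    8, the midpoint of an interior edge to 2. *)
Definition element_mass (c a b p q r : F) : F :=
  8 / 3 * s c + 4 / 3 * (s a + s b) + 16 / 3 * (s p + s q + s r).

(** These squares vanish when [p] and [q] are opposite to the four other
    values, all equal. *)
Definition element_gap (c a b p q r : F) : F :=
  2 / 3 * (s (p + c) + s (p + a) + s (q + c) + s (q + b))
  + 4 / 3 * (s (p + r) + s (q + r)) + (s (c - a) + s (c - b)) / 6.

Lemma element_energy_sesquilinear c a b p q r : element_energy c a b p q r =
  let e x y := sigma x * y + sigma y * x in
  (8 * s c + 4 * (s a + s b) + 64 / 3 * (s p + s q + s r)) / 8
  + (e c a + e c b) / 6 - 2 / 3 * (e c p + e c q + e a p + e b q)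
  - 4 / 3 * (e r p + e r q).
Proof.
rewrite /element_energy !(rmorphB, rmorphD, rmorphM, rmorph_nat) /=; by field.
Qed.

(** Summed over the mesh, this is the Gershgorin bound for the stiffness matrix
    with the slack written as a sum of squares, from which the case of equality
    can be read off. *)
Lemma element_energyD_gap c a b p q r :
  element_energy c a b p q r + element_gap c a b p q r =
  element_mass c a b p q r.
Proof.
rewrite /element_energy /element_gap /element_mass.
rewrite !(rmorphB, rmorphD, rmorphM, rmorph_nat) /=; by field.
Qed.

Hypothesis s_ge0 : forall x, 0 <= s x.

Local Ltac sum_ge0 :=
  do ?[exact: s_ge0 | apply: addr_ge0 | apply: mulr_ge0]; rewrite ?invr_ge0 //.

Lemma element_energy_ge0 c a b p q r : 0 <= element_energy c a b p q r.
Proof. by rewrite /element_energy; sum_ge0. Qed.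

Lemma element_gap_ge0 c a b p q r : 0 <= element_gap c a b p q r.
Proof. by rewrite /element_gap; sum_ge0. Qed.

Hypothesis s_eq0 : forall x, s x = 0 -> x = 0.

Let scale_eq0 (k x : F) : k != 0 -> k * s x == 0 -> x = 0.
Proof. by move=> k0; rewrite mulf_eq0 (negPf k0) => /eqP/s_eq0. Qed.

(** A vanishing energy makes all six values equal, a vanishing gap makes [p] and
    [q] opposite to the others.  The conclusion of both lemmas is what these
    two cases have in common. *)
Lemma element_energy_eq0 c a b p q r : element_energy c a b p q r = 0 ->
  [/\ a = c, b = c & c = 0 -> [/\ p = 0, q = 0 & r = 0]].
Proof.
have k0 n : n.+1%:R != 0 :> F by rewrite pnatr_eq0.
have half (x y z : F) : (s x + 2 * s y + 8 * s z) / 6 == 0 ->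
    [/\ x = 0, y = 0 & z = 0].
  rewrite mulf_eq0 invr_eq0 pnatr_eq0 orbF !paddr_eq0; try by sum_ge0.
  move=> /andP[/andP[/eqP/s_eq0 x0 y0 z0]].
  by rewrite x0 (scale_eq0 _ y0) ?(scale_eq0 _ z0).
move/eqP; rewrite paddr_eq0; try by sum_ge0.
move=> /andP[/half[/subr0_eq-> + /subr0_eq->] /half[/subr0_eq-> + _]].
move=> pc qc; split=> // c0; move: pc qc.
rewrite c0 !add0r => /eqP; rewrite oppr_eq0 mulf_eq0 (negPf (k0 _)) => /eqP->.
by move=> /eqP; rewrite oppr_eq0 mulf_eq0 (negPf (k0 _)) => /eqP->.
Qed.

Lemma element_gap_eq0 c a b p q r : element_gap c a b p q r = 0 ->
  [/\ a = c, b = c & c = 0 -> [/\ p = 0, q = 0 & r = 0]].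
Proof.
have scale n m (x : F) : (n.+1%:R / m.+1%:R * x == 0) = (x == 0).
  by rewrite !mulf_eq0 invr_eq0 !pnatr_eq0.
have div6 (x : F) : (x / 6 == 0) = (x == 0).
  by rewrite !mulf_eq0 invr_eq0 !pnatr_eq0 orbF.
move/eqP; rewrite /element_gap !paddr_eq0; try by sum_ge0.
rewrite (scale 1 2)%N (scale 3 2)%N div6 !paddr_eq0; try by sum_ge0.
move=> /andP[/andP[/andP[/andP[/andP[+ _] +] _]] /andP[+ _]] /andP[].
move=> /eqP/s_eq0 pc /eqP/s_eq0 qc /eqP/s_eq0 pr.
move=> /eqP/s_eq0/subr0_eq<- /eqP/s_eq0/subr0_eq<-; split=> // c0.
move: pc qc pr; rewrite c0 !addr0 => -> ->.
by rewrite add0r.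
Qed.

End ElementForms.

(** * The symbol *)

Section Symbol.
Context {R : realType}.
Local Notation C := R[i].
Local Notation "x %:C" := (real_complex R x).

Lemma expiD (x y : R) : expi (x + y) = expi x * expi y.
Proof. by rewrite /expi cosD sinD; congr Complex; rewrite addrC. Qed.

Lemma expiN (x : R) : expi (- x) = (expi x)^*.
Proof. by rewrite /expi cosN sinN. Qed.

Lemma expi_mulJ (x : R) : expi x * (expi x)^* = 1.
Proof.
rewrite -expiN -expiD subrr /expi cos0 sin0 //.
Qed.

Lemma expi_neq0 (x : R) : expi x != 0.
Proof.
by apply: contraTneq (oner_neq0 C) => e0; rewrite -(expi_mulJ x) e0 mul0r eqxx.
Qed.

Lemma conj_expi (x : R) : (expi x)^* = (expi x)^-1.
Proof. by apply: (mulfI (expi_neq0 x)); rewrite expi_mulJ divff ?expi_neq0. Qed.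

Lemma Ghat_hermitian (t : R * R) : Ghat t \is hermsymmx.
Proof.
apply/is_hermitianmxP; rewrite expr0 scale1r.
have cb (x : C) : (- (4 / 3) * x)^* = - (4 / 3) * x^*.
  by rewrite rmorphM rmorphN fmorph_div !rmorph_nat.
have c1 : (- (4 / 3) : C)^* = - (4 / 3) by rewrite -[X in X^*]mulr1 cb conjC1 mulr1.
have c2 (x : C) : (2 * x)^* = 2 * x^* by rewrite rmorphM rmorph_nat.
have cd : (16 / 3 : C)^* = 16 / 3 by rewrite fmorph_div !rmorph_nat.
have c4 : (4 : C)^* = 4 by rewrite rmorph_nat.
apply/matrixP => i j; rewrite !mxE; move: (h3 t) => h.
case: i => [[|[|[|[|[|[|[|[|i]]]]]]]] ?] //;
  case: j => [[|[|[|[|[|[|[|[|j]]]]]]]] ?] //=;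
  by rewrite ?conjC0 ?cd ?c4 ?cb ?c1 ?c2 -?expiN ?conjCK ?opprK.
Qed.

(** The four triangles of a cell at frequency [t], in the order bottom, right,
    top, left.  Component 2 of [v] is the value at the centre and 7 that at the
    lower left corner; 3 and 6 are on the midpoints of the lower and left sides,
    and 4, 1, 0, 5 on those of the half-diagonals, counterclockwise from the
    lower left one, where 5 is shifted by one cell.  A factor [expi t.1] or
    [expi t.2] moves a value to the neighbouring cell. *)
Definition symbol_sum (form : C -> C -> C -> C -> C -> C -> C) (t : R * R)
    (v : 'cV[C]_8) : C :=
  let e1 := expi t.1 in let e2 := expi t.2 in
  let v k (k8 : (k < 8)%N) := v (Ordinal k8) 0 in
  let v0 := v 0%N isT in let v1 := v 1%N isT in let v2 := v 2%N isT in
  let v3 := v 3%N isT in let v4 := v 4%N isT in let v5 := v 5%N isT in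
  let v6 := v 6%N isT in let v7 := v 7%N isT in
  form v2 v7 (e1 * v7) v4 v1 v3 +
  form v2 (e1 * v7) (e2 * (e1 * v7)) v1 v0 (e1 * v6) +
  form v2 (e2 * (e1 * v7)) (e2 * v7) v0 (e2 * v5) (e2 * v3) +
  form v2 (e2 * v7) v7 (e2 * v5) v4 v6.

Lemma big_ord8 (V : nmodType) (f : 'I_8 -> V) : \sum_i f i =
  f (@Ordinal 8 0 isT) + f (@Ordinal 8 1 isT) + f (@Ordinal 8 2 isT)
  + f (@Ordinal 8 3 isT) + f (@Ordinal 8 4 isT) + f (@Ordinal 8 5 isT)
  + f (@Ordinal 8 6 isT) + f (@Ordinal 8 7 isT).
Proof.
rewrite !big_ord_recr big_ord0 /= add0r.
by do !congr (_ + _); congr f; apply: val_inj.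
Qed.

Lemma symbol_energyE t v :
  hform (Ghat t) v = symbol_sum (element_energy Num.conj) t v.
Proof.
rewrite hformE big_ord8 !big_ord8.
(* The rows are named so that the 64 entries are read off one list. *)
evar (rows : seq (seq C)).
have GE i j : Ghat t i j = nth 0 (nth [::] rows i) j by rewrite mxE /rows.
rewrite !GE {GE} /rows /=.
rewrite /symbol_sum !element_energy_sesquilinear /=.
have e10 := expi_neq0 t.1; have e20 := expi_neq0 t.2.
have c1 x : (expi t.1 * x)^* = (expi t.1)^-1 * x^* by rewrite rmorphM /= conj_expi.
have c2 x : (expi t.2 * x)^* = (expi t.2)^-1 * x^* by rewrite rmorphM /= conj_expi.
have ch : (h3 t)^* = 6^-1 * (1 + (expi t.1)^-1) * (1 + (expi t.2)^-1).
  by rewrite /h3 !(rmorphM, rmorphD, fmorphV, rmorph_nat, rmorph1) /= !conj_expi.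
rewrite ch /h3 !expiN !conj_expi expiD !(c1, c2) /=.
move: (expi t.1) (expi t.2) e10 e20 {c1 c2 ch} => e1 e2 e10 e20.
by field; rewrite e10 e20.
Qed.

Lemma symbol_massE t v :
  symbol_sum (element_mass Num.conj) t v = 32 / 3 * sqnorm v.
Proof.
rewrite sqnormE big_ord8 /symbol_sum /element_mass /=.
have e10 := expi_neq0 t.1; have e20 := expi_neq0 t.2.
have c1 x : (expi t.1 * x)^* = (expi t.1)^-1 * x^* by rewrite rmorphM /= conj_expi.
have c2 x : (expi t.2 * x)^* = (expi t.2)^-1 * x^* by rewrite rmorphM /= conj_expi.
rewrite !(c1, c2) /=.
move: (expi t.1) (expi t.2) e10 e20 {c1 c2} => e1 e2 e10 e20.
by field; rewrite e10 e20.
Qed.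

Let sq_ge0 (x : C) : 0 <= Num.conj x * x.
Proof. by rewrite mulrC mul_conjC_ge0. Qed.

Lemma Ghat_bounds t (v : 'cV[C]_8) : 0 <= hform (Ghat t) v <= 32 / 3 * sqnorm v.
Proof.
have energy_ge0 := element_energy_ge0 sq_ge0.
have energy_le (c a b p q r : C) : element_energy Num.conj c a b p q r <=
    element_mass Num.conj c a b p q r.
  by rewrite -element_energyD_gap lerDl (element_gap_ge0 sq_ge0).
rewrite symbol_energyE -(symbol_massE t) /symbol_sum.
by rewrite !(energy_ge0, energy_le, addr_ge0, lerD).
Qed.

(** Constant for [false]; for [true], the sign is opposite on the midpoints of
    the half-diagonals (components 0, 1, 4, 5) and on the other nodes. *)
Definition sign_mode (b : bool) : 'cV[C]_8 :=
  \col_i (if (i : nat) \in [:: 0; 1; 4; 5]%N then 1 else (-1) ^+ b).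

Lemma sqnorm_sign_mode b : sqnorm (sign_mode b) = 8.
Proof.
rewrite sqnormE big_ord8 !mxE /= !rmorph_sign /= conjC1.
by case: b => /=; ring.
Qed.

Definition sign_mode_energy (b : bool) (t : R * R) : R :=
  40 - (-1) ^+ b * (8 / 3 * (9 + 3 * cos t.1 + 3 * cos t.2 + cos (t.1 + t.2)))
  + 2 / 3 * (1 + cos t.1 + cos t.2 + cos (t.1 + t.2)).

(** The Rayleigh quotient of a fixed vector depends continuously on the
    frequency, which spares the continuity of the eigenvalues. *)
Lemma sign_mode_energyE b t :
  hform (Ghat t) (sign_mode b) = (sign_mode_energy b t)%:C.
Proof.
have e10 := expi_neq0 t.1; have e20 := expi_neq0 t.2.
have cosE (x : R) : (cos x)%:C = (expi x + (expi x)^-1) / 2.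
  by rewrite -conj_expi; simpc; congr Complex; field.
have -> : (sign_mode_energy b t)%:C =
    40 - (-1) ^+ b * (8 / 3 * (9 + 3 * (cos t.1)%:C + 3 * (cos t.2)%:C
      + (cos (t.1 + t.2))%:C))
    + 2 / 3 * (1 + (cos t.1)%:C + (cos t.2)%:C + (cos (t.1 + t.2))%:C).
  by rewrite !(rmorphB, rmorphD, rmorphM, rmorph_nat, fmorphV, rmorph1, rmorph_sign).
rewrite !cosE expiD.
rewrite symbol_energyE /symbol_sum !element_energy_sesquilinear /= !mxE /=.
have c1 x : (expi t.1 * x)^* = (expi t.1)^-1 * x^* by rewrite rmorphM /= conj_expi.
have c2 x : (expi t.2 * x)^* = (expi t.2)^-1 * x^* by rewrite rmorphM /= conj_expi.
rewrite !(c1, c2) !rmorph_sign !conjC1.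
move: (expi t.1) (expi t.2) e10 e20 {c1 c2} => e1 e2 e10 e20.
by case: b => /=; field; rewrite e10 e20.
Qed.

Lemma Ghat_mode_near (b : bool) (eps : R) : 0 < eps ->
  \forall t \near ((0, 0) : R * R),
    `|sign_mode_energy b t - sign_mode_energy b (0, 0)| < eps.
Proof.
move=> eps0.
have cont : {for (0, 0), continuous (sign_mode_energy b)}.
  have c1 : {for (0 : R, 0 : R), continuous (fun t : R * R => cos t.1)}.
    by apply: continuous_comp; [exact: cvg_fst|exact: continuous_cos].
  have c2 : {for (0 : R, 0 : R), continuous (fun t : R * R => cos t.2)}.
    by apply: continuous_comp; [exact: cvg_snd|exact: continuous_cos].
  have c3 : {for (0 : R, 0 : R), continuous (fun t : R * R => cos (t.1 + t.2))}.
    apply: continuous_comp; last exact: continuous_cos.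
    by apply: cvgD; [exact: cvg_fst|exact: cvg_snd].
  rewrite /sign_mode_energy.
  repeat first [exact: c1|exact: c2|exact: c3|exact: cvg_cst
    |apply: cvgD|apply: cvgN|apply: cvgM].
have /cvgr_distC_lt := cont; exact.
Qed.

Lemma Ghat_mode0 b : sign_mode_energy b (0, 0) = if b then 32 / 3 * 8 else 0.
Proof.
rewrite /sign_mode_energy /= addr0 cos0; case: b => /=; by field.
Qed.

Lemma lambda_Ghat_bounds (t : R * R) (j : 'I_8) :
  0 <= lambda (Ghat t) j <= 32 / 3.
Proof.
rewrite -ler0c -lecR !rmorphM fmorphV !rmorph_nat.
apply: lambda_bounds (Ghat_hermitian t) _ => v.
by rewrite mul0r Ghat_bounds.
Qed.

Lemma lambda_min_Ghat_ge0 (t : R * R) : 0 <= lambda_min (Ghat t).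
Proof. by have /andP[] := lambda_Ghat_bounds t (@Ordinal 8 7 isT). Qed.

Lemma lambda_max_Ghat_le (t : R * R) : lambda_max (Ghat t) <= 32 / 3.
Proof. by have /andP[] := lambda_Ghat_bounds t (@Ordinal 8 0 isT). Qed.

Lemma lambda_min_Ghat_le t : lambda_min (Ghat t) <= sign_mode_energy false t / 8.
Proof.
rewrite ler_pdivlMr // -lecR -sign_mode_energyE rmorphM rmorph_nat.
by rewrite -(sqnorm_sign_mode false) lambda_min_le_hform // Ghat_hermitian.
Qed.

Lemma lambda_max_Ghat_ge t : sign_mode_energy true t / 8 <= lambda_max (Ghat t).
Proof.
rewrite ler_pdivrMr // -lecR -sign_mode_energyE rmorphM rmorph_nat.
by rewrite -(sqnorm_sign_mode true) hform_le_lambda_max // Ghat_hermitian.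
Qed.

Lemma lambda_min_Ghat0 : lambda_min (Ghat (0, 0)) = 0 :> R.
Proof.
apply/eqP; rewrite eq_le lambda_min_Ghat_ge0 andbT.
by rewrite (le_trans (lambda_min_Ghat_le _)) // Ghat_mode0 mul0r.
Qed.

Lemma lambda_max_Ghat0 : lambda_max (Ghat (0, 0)) = 32 / 3 :> R.
Proof.
apply/eqP; rewrite eq_le lambda_max_Ghat_le /=.
by rewrite (le_trans _ (lambda_max_Ghat_ge _)) // Ghat_mode0 mulfK.
Qed.

End Symbol.

(** * Null sets and essential bounds *)

Section ProductNegligible.
Context d1 d2 (T1 : measurableType d1) (T2 : measurableType d2) (R : realType).
Variable m1 : {measure set T1 -> \bar R}.
Variable m2 : {sigma_finite_measure set T2 -> \bar R}.

(** Almost all sections of a null set of the product are null, but above a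
    point of [E] the section contains [U]. *)
Lemma setX_negligible (E : set T1) (U : set T2) :
  (forall B, measurable B -> U `<=` B -> (0 < m2 B)%E) ->
  (m1 \x m2)%E.-negligible (E `*` U) -> m1.-negligible E.
Proof.
move=> U0 [B [mB B0 EUB]].
have mf := measurable_fun_xsection m2 mB.
have /(ae_eq_integral_abs m1 measurableT mf) :
    (\int[m1]_(z in setT) `|m2 (xsection B z)|)%E = 0%E.
  by rewrite -[RHS]B0; apply: eq_integral => z _; rewrite gee0_abs.
apply: negligibleS => z Ez /= /(_ I) z0.
have := U0 _ (measurable_xsection z mB); rewrite z0 ltxx => H.
suff : false by []; apply: H => t Ut.
by rewrite /xsection /= inE; exact: EUB.
Qed.

End ProductNegligible.

Section EssentialBounds.
Context {R : realType}.
Implicit Types (mu : R * R -> R) (p : R * R).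

Local Notation leb2 := (@leb2 R).
Local Notation msq := (mrestr leb2 measurable_square).

HB.instance Definition _ := Measure.on leb2.

Let leb2_sigma_finite : sigma_finite setT leb2.
Proof.
have /sigma_finiteP[F [TF ndF Foo]] := sigma_finiteT (@lebesgue_measure R).
exists (fun n => F n `*` F n).
  rewrite -setXTT TF predeqE => -[x y]; split; last first.
    by move=> [n _ []/= ? ?]; split; exists n.
  move=> [/= [n _ Fnx] [k _ Gky]]; exists (maxn n k) => //; split.
    by move: x Fnx; exact/subsetPset/ndF/leq_maxl.
  by move: y Gky; exact/subsetPset/ndF/leq_maxr.
move=> k; have [? ?] := Foo k; split; first exact: measurableX.
rewrite [X in (X < _)%E]product_measure1E// lte_mul_pinfty// ge0_fin_numE //.
Qed.

HB.instance Definition _ := Measure_isSigmaFinite.Build _ _ _ leb2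
  leb2_sigma_finite.

Lemma leb2_box (a b c d : R) : a <= b -> c <= d ->
  leb2 (`]a, b[ `*` `]c, d[) = ((b - a) * (d - c))%:E.
Proof.
have len (x y : R) : x <= y -> lebesgue_measure `]x, y[%classic = (y - x)%:E.
  rewrite lebesgue_measure_itv /= lte_fin.
  by case: ltgtP => // -> _; rewrite subrr.
move=> ab cd; rewrite EFinM -len // -len //.
exact: product_measure1E.
Qed.

Lemma nbhs_box p (U : set (R * R)) : nbhs p U ->
  exists2 e : R, 0 < e &
    `]p.1 - e, p.1 + e[ `*` `]p.2 - e, p.2 + e[ `<=` U.
Proof.
case=> -[A B] /= [/nbhs_ballP[d d0 dA] /nbhs_ballP[e e0 eB]] ABU.
exists (Num.min d e) => /=; first by rewrite lt_min d0 e0.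
move=> [x y] /= []; rewrite !in_itv /= => /andP[x1 x2] /andP[y1 y2].
apply: ABU; split => /=.
  apply: dA => /=; rewrite /ball /= ltr_distlC.
  by rewrite (le_lt_trans _ x1) ?(lt_le_trans x2) ?lerD2l ?lerN2 ?ge_min ?lexx.
apply: eB => /=; rewrite /ball /= ltr_distlC.
by rewrite (le_lt_trans _ y1) ?(lt_le_trans y2) ?lerD2l ?lerN2 ?ge_min ?lexx ?orbT.
Qed.

Lemma box_measurable (a b c d : R) : measurable (`]a, b[ `*` `]c, d[ : set (R * R)).
Proof. by apply: measurableX; exact: measurable_itv. Qed.

Lemma leb2_nbhs_gt0 p (U B : set (R * R)) :
  nbhs p U -> measurable B -> U `<=` B -> (0 < leb2 B)%E.
Proof.
move=> /nbhs_box[e e0 eU] mB UB.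
apply: (@lt_le_trans _ _ (leb2 (`]p.1 - e, p.1 + e[ `*` `]p.2 - e, p.2 + e[))).
  by rewrite leb2_box ?lte_fin ?mulr_gt0 //; lra.
by apply: le_measure; rewrite ?inE //; [exact: box_measurable|exact: subset_trans UB].
Qed.

Lemma nbhs_not_negligible p (U : set (R * R)) : nbhs p U -> ~ leb2.-negligible U.
Proof.
by move=> pU [B [mB B0 UB]]; have := leb2_nbhs_gt0 pU mB UB; rewrite B0 ltxx.
Qed.

Lemma mrestr_negligible (A : set (R * R)) :
  msq.-negligible A <-> leb2.-negligible (A `&` square).
Proof.
split=> -[B [mB B0 AB]].
  exists (B `&` square); split=> //; last exact: setSI.
  exact: measurableI mB measurable_square.
exists (B `|` ~` square); split.
- by apply: measurableU => //; exact: measurableC measurable_square.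
- apply/eqP; rewrite -measure_le0 -B0 /= /mrestr; apply: le_measure.
  + rewrite inE; apply: measurableI; last exact: measurable_square.
    by apply: measurableU => //; exact: measurableC measurable_square.
  + by rewrite inE.
  + by move=> x [[//|nx] /nx].
- by move=> x Ax; have [xs|xs] := pselect (square x); [left; apply: AB|right].
Qed.

Lemma open_square_nbhs p : open_square p -> nbhs p (@open_square R).
Proof.
move=> [p1 p2]; exists (`]0, 1[%classic, `]0, 1[%classic) => //=.
by split; apply: near_in_itvoo.
Qed.

Lemma open_square_sub : @open_square R `<=` square.
Proof. by move=> p [p1 p2]; split; exact: subset_itv_oo_cc. Qed.

Lemma msq_gt0 : (0 < msq setT)%E.
Proof.
rewrite /= /mrestr setTI.
apply: (leb2_nbhs_gt0 (open_square_nbhs (p := (2^-1, 2^-1)) _)).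
- by split; rewrite /= in_itv /=; lra.
- exact: measurable_square.
- exact: open_square_sub.
Qed.

Definition bounded_on_square mu := exists B, forall p, square p -> `|mu p| <= B.

Lemma ae_square (P : R * R -> Prop) :
  (forall p, square p -> P p) -> \forall p \ae msq, P p.
Proof.
move=> H; apply/mrestr_negligible; apply: negligibleS (negligible_set0 _).
by move=> p [/= nP /H].
Qed.

Lemma ess_sup_fin mu : bounded_on_square mu ->
  ess_sup msq (EFin \o mu) = (esssup mu)%:E.
Proof.
move=> [B hB]; rewrite /esssup fineK // fin_numElt; apply/andP; split.
  apply: (@lt_le_trans _ _ (- B)%:E); first exact: ltNyr.
  apply: ess_sup_gee; first exact: msq_gt0.
  by apply: ae_square => p /hB; rewrite lee_fin ler_norml => /andP[].
apply: (@le_lt_trans _ _ B%:E); last exact: ltry.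
apply/ess_supP; apply: ae_square => p /hB /=.
by rewrite lee_fin ler_norml => /andP[].
Qed.

Lemma ess_inf_fin mu : bounded_on_square mu ->
  ess_inf msq (EFin \o mu) = (essinf mu)%:E.
Proof.
move=> [B hB]; rewrite /essinf fineK // fin_numElt; apply/andP; split.
  apply: (@lt_le_trans _ _ (- B)%:E); first exact: ltNyr.
  apply/ess_infP; apply: ae_square => p /hB /=.
  by rewrite lee_fin ler_norml => /andP[].
apply: (@le_lt_trans _ _ B%:E); last exact: ltry.
rewrite -[leRHS](ess_inf_cst _ msq_gt0); apply: le_ess_inf.
by apply: ae_square => p /hB; rewrite lee_fin ler_norml => /andP[].
Qed.

Lemma essinf_ge0 mu : bounded_on_square mu ->
  (forall p, square p -> 0 < mu p) -> 0 <= essinf mu.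
Proof.
move=> mub mu0; rewrite -lee_fin -ess_inf_fin //; apply/ess_infP.
by apply: ae_square => p /mu0/ltW; rewrite lee_fin.
Qed.

(** A value beyond an essential bound at a point of continuity would exceed it
    on a neighbourhood. *)
Lemma essential_bounds_at mu p : bounded_on_square mu -> open_square p ->
  {for p, continuous mu} -> essinf mu <= mu p <= esssup mu.
Proof.
move=> mub po cp; have ps := open_square_nbhs po.
apply/andP; split; rewrite leNgt; apply/negP => lt.
  have /= := @ess_inf_le _ _ _ msq (EFin \o mu).
  rewrite ess_inf_fin // => /mrestr_negligible.
  apply: (@nbhs_not_negligible p).
  have /= := cvgr_lt _ cp _ lt => near_p.
  near=> q; split => /=.
    rewrite lee_fin; apply/negP; rewrite -ltNge; near: q; exact: near_p.
  by apply: open_square_sub; near: q.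
have /= := @ess_sup_ge _ _ _ msq (EFin \o mu).
rewrite ess_sup_fin // => /mrestr_negligible.
apply: (@nbhs_not_negligible p).
have /= := cvgr_gt _ cp _ lt => near_p.
near=> q; split => /=.
  rewrite lee_fin; apply/negP; rewrite -ltNge; near: q; exact: near_p.
by apply: open_square_sub; near: q.
Unshelve. all: by end_near. Qed.

(** Otherwise [esssup mu - d] would be an essential upper bound. *)
Lemma esssup_not_negligible mu (d : R) : bounded_on_square mu -> 0 < d ->
  ~ leb2.-negligible (square `&` [set p | `|mu p - esssup mu| < d]).
Proof.
move=> mub d0 neg.
suff : ((esssup mu)%:E <= (esssup mu - d)%:E)%E.
  by rewrite lee_fin lerBrDr gerDl leNgt d0.
rewrite -ess_sup_fin //; apply/ess_supP.
have /= ae1 := @ess_sup_ge _ _ _ msq (EFin \o mu).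
have {}neg : \forall p \ae msq, ~ `|mu p - esssup mu| < d.
  apply/mrestr_negligible; apply: negligibleS neg => p [/= /contrapT ? ?].
  by split.
rewrite ess_sup_fin // in ae1; near=> p.
rewrite /= lee_fin leNgt; apply/negP => lt.
have : ~ `|mu p - esssup mu| < d by near: p.
have : ((mu p)%:E <= (esssup mu)%:E)%E by near: p.
rewrite lee_fin => le; apply.
by rewrite ltr_distl (le_lt_trans le) ?lt //; lra.
Unshelve. all: by end_near. Qed.

Lemma setX_not_negligible (E U : set (R * R)) p :
  ~ leb2.-negligible E -> nbhs p U -> ~ (leb2 \x leb2)%E.-negligible (E `*` U).
Proof.
move=> nE pU neg; apply: nE.
apply: setX_negligible neg => B; exact: leb2_nbhs_gt0 pU.
Qed.

End EssentialBounds.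

(** * Integrals of quadratic functions over triangles *)

Section WedgeIntegral.
Context {R : realType}.
Local Notation leb := (@lebesgue_measure R).

Lemma integral_deriv_poly (P : {poly R}) (a b : R) : a <= b ->
  (\int[leb]_(x in `]a, b[) (P^`().[x])%:E)%E = (P.[b] - P.[a])%:E.
Proof.
rewrite le_eqVlt => /predU1P[->|ab].
  by rewrite set_itvoo0 integral_set0 subrr.
rewrite -(@integral_itv_bndoo _ a b _ true false); last first.
  apply/measurable_EFinP; apply: measurable_funTS.
  by apply: continuous_measurable_fun; exact: continuous_horner.
rewrite (@continuous_FTC2 _ _ (horner P)) //.
- by apply: continuous_subspaceT; exact: continuous_horner.
- split.
  + by move=> x _; exact: derivable_horner.
  + by apply: cvg_at_right_filter; exact: continuous_horner.
  + by apply: cvg_at_left_filter; exact: continuous_horner.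
- by move=> x _; rewrite derivE.
Qed.

Lemma integral_cubic (x0 a b c0 c1 c2 c3 : R) :
  let G y := c0 * y + c1 / 2 * y ^+ 2 + c2 / 3 * y ^+ 3 + c3 / 4 * y ^+ 4 in
  a <= b ->
  (\int[leb]_(x in `]a, b[)
     (c0 + c1 * (x - x0) + c2 * (x - x0) ^+ 2 + c3 * (x - x0) ^+ 3)%:E)%E
  = (G (b - x0) - G (a - x0))%:E.
Proof.
move=> G ab; pose Y : {poly R} := 'X - x0%:P.
pose P := c0 *: Y + (c1 / 2) *: Y ^+ 2 + (c2 / 3) *: Y ^+ 3 + (c3 / 4) *: Y ^+ 4.
have PE x : P.[x] = G (x - x0) by rewrite /P /Y /G !hornerE.
rewrite -!PE -integral_deriv_poly //; apply: eq_integral => x _.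
congr EFin; rewrite /P /Y !poly.derivE; rewrite !hornerE.
by rewrite /=; field.
Qed.

Definition quadratic (q0 qS qT qSS qST qTT S T : R) : R :=
  q0 + qS * S + qT * T + qSS * S ^+ 2 + qST * (S * T) + qTT * T ^+ 2.

(** The integral over the triangle [|T| < S < w]; the terms odd in [T]
    cancel. *)
Definition quadratic_wedge_integral (w q0 qS qSS qTT : R) : R :=
  w ^+ 2 * q0 + 2 / 3 * w ^+ 3 * qS + w ^+ 4 / 2 * qSS + w ^+ 4 / 6 * qTT.

Variables (w q0 qS qT qSS qST qTT : R).
Hypothesis w0 : 0 < w.
Local Notation quad := (quadratic q0 qS qT qSS qST qTT).

Variables (z0 y0 s t : R).
Hypotheses (s1 : s = 1 \/ s = -1) (t1 : t = 1 \/ t = -1).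

(** The outer variable [z] is [S] up to sign and translation, the inner one [y]
    is [T]: the slices are intervals [|T| < S]. *)
Definition wedge_fun (z y : R) : R :=
  let S := s * (z - z0) in let T := t * (y - y0) in
  if (`|T| < S) && (S < w) then quad S T else 0.

Let inner (z : R) :
  (\int[leb]_y (wedge_fun z y)%:E)%E =
  let S := s * (z - z0) in
  (if (0 < S < w) then 2 * q0 * S + 2 * qS * S ^+ 2 + (2 * qSS + 2 / 3 * qTT) * S ^+ 3
   else 0)%:E.
Proof.
set S := s * (z - z0); rewrite /=; have [/andP[S0 Sw]|nS] := ifPn; last first.
  under eq_integral => y _.
    rewrite (_ : wedge_fun z y = 0); first over.
    rewrite /wedge_fun; case: ifPn => // /andP[TS Sw]; exfalso; move/negP: nS; apply.
    by rewrite -/S in Sw TS; rewrite Sw (le_lt_trans _ TS).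
  by rewrite integral0.
transitivity (\int[leb]_(y in `](y0 - S)%R, (y0 + S)%R[) (quad S (t * (y - y0)))%:E)%E.
  rewrite [RHS]integral_mkcond; apply: eq_integral => y _.
  rewrite patchE /wedge_fun -/S Sw andbT.
  have -> : (y \in `]y0 - S, y0 + S[%classic) = (`|t * (y - y0)| < S).
    rewrite mem_setE in_itv /= -ltr_distl normrM.
    by case: t1 => ->; rewrite ?normrN normr1 mul1r.
  by case: ifP.
under eq_integral => y _.
  rewrite (_ : quad S _ = (q0 + qS * S + qSS * S ^+ 2) + (t * (qT + qST * S)) * (y - y0)
     + qTT * (y - y0) ^+ 2 + 0 * (y - y0) ^+ 3); first over.
  by rewrite /quadratic; case: t1 => ->; ring.
rewrite integral_cubic; last by lra.
congr EFin; by field.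
Qed.

Lemma iterated_wedge_integral :
  (\int[leb]_z \int[leb]_y (wedge_fun z y)%:E)%E =
  (quadratic_wedge_integral w q0 qS qSS qTT)%:E.
Proof.
under eq_integral do rewrite inner /=.
have cubicE (a b : R) : a <= b ->
    (forall z, (z \in `]a, b[%classic) = (0 < s * (z - z0) < w)) ->
    (\int[leb]_z (let S := (s * (z - z0))%R in
      (if 0 < S < w then 2 * q0 * S + 2 * qS * S ^+ 2 + (2 * qSS + 2 / 3 * qTT) * S ^+ 3
       else 0)%R%:E))%E =
    (\int[leb]_(z in `]a, b[) (0 + s * (2 * q0) * (z - z0) + 2 * qS * (z - z0) ^+ 2
      + s * (2 * qSS + 2 / 3 * qTT) * (z - z0) ^+ 3)%:E)%E.
  move=> ab abE; rewrite [RHS]integral_mkcond; apply: eq_integral => z _.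
  rewrite patchE abE /=; case: ifP => // _; congr EFin.
  by case: s1 => ->; ring.
case: (s1) => sE.
  rewrite (cubicE z0 (z0 + w)); first last.
  - by move=> z; rewrite mem_setE in_itv /= sE mul1r subr_gt0 ltrBlDl.
  - by rewrite lerDl ltW.
  rewrite integral_cubic ?lerDl ?(ltW w0) // /quadratic_wedge_integral sE.
  by congr EFin; field.
rewrite (cubicE (z0 - w) z0); first last.
- move=> z; rewrite mem_setE in_itv /= sE mulN1r opprB subr_gt0 andbC.
  by rewrite ltrBlDr ltrBlDl addrC.
- by rewrite gerBl ltW.
rewrite integral_cubic ?gerBl ?(ltW w0) // /quadratic_wedge_integral sE.
by congr EFin; field.
Qed.

End WedgeIntegral.

Section Wedge.
Context {R : realType}.
Local Notation leb2 := (@leb2 R).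

Definition axis_direction (d : R * R) : Prop :=
  (d.1 = 0 /\ (d.2 = 1 \/ d.2 = -1)) \/ (d.2 = 0 /\ (d.1 = 1 \/ d.1 = -1)).

(** Coordinates with origin [o]: along [d], and across it, in the direction [d]
    turned clockwise by a right angle. *)
Definition along (o d p : R * R) : R := d.1 * (p.1 - o.1) + d.2 * (p.2 - o.2).
Definition across (o d p : R * R) : R := d.2 * (p.1 - o.1) - d.1 * (p.2 - o.2).

Definition wedge (o d : R * R) (w : R) : set (R * R) :=
  [set p | `|along o d p| < across o d p < w].

Variables (o d : R * R) (w : R).
Hypotheses (w0 : 0 < w) (dP : axis_direction d).
Local Notation S := (across o d).
Local Notation T := (along o d).

Lemma measurable_along : measurable_fun [set: R * R] (along o d).
Proof.
apply: measurable_funD; apply: measurable_funM => //; apply: measurable_funB => //.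
Qed.

Lemma measurable_across : measurable_fun [set: R * R] (across o d).
Proof.
apply: measurable_funB; apply: measurable_funM => //; apply: measurable_funB => //.
Qed.

Lemma measurable_wedge : measurable (wedge o d w).
Proof.
have -> : wedge o d w =
    [set: R * R] `&` ((fun p => S p - `|T p|) @^-1` `]0, +oo[) `&`
    ([set: R * R] `&` S @^-1` `]-oo, w[).
  apply/seteqP; split => [p /= /andP[TS Sw]|p /= [[_ +] [_ +]]].
    by rewrite !in_itv /= andbT subr_gt0 TS Sw.
  by rewrite !in_itv /= andbT subr_gt0 /wedge /= => -> ->.
apply: measurableI.
  apply: (measurable_funB measurable_across) => //.
  exact: (measurableT_comp (@normr_measurable R setT) measurable_along).
exact: measurable_across.
Qed.

Lemma leb2_wedge_fin : (leb2 (wedge o d w) < +oo)%E.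
Proof.
apply: (@le_lt_trans _ _ (leb2 (`]o.1 - w, o.1 + w[ `*` `]o.2 - w, o.2 + w[))).
  apply: le_measure; rewrite ?inE; [exact: measurable_wedge|exact: box_measurable|].
  move=> p /= /andP[]; rewrite /along /across.
  case: dP => -[-> [->|->]] /=;
  rewrite !in_itv /= !(mul0r, mul1r, mulN1r, add0r, sub0r, subr0, addr0, opprK);
  rewrite ?normrN ltr_norml => /andP[? ?] ?; split; lra.
by rewrite leb2_box ?ltry //; have := w0; lra.
Qed.

Variables (q0 qS qT qSS qST qTT : R).
Local Notation quad := (quadratic q0 qS qT qSS qST qTT).

Lemma measurable_quad : measurable_fun [set: R * R] (fun p => quad (S p) (T p)).
Proof.
have mS := measurable_across; have mT := measurable_along.
rewrite /quadratic; repeat apply: measurable_funD => //; apply: measurable_funM => //.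
- exact: measurable_funX.
- exact: measurable_funM.
- exact: measurable_funX.
Qed.

Lemma integrable_quad :
  leb2.-integrable (wedge o d w) (EFin \o (fun p => quad (S p) (T p))).
Proof.
apply: measurable_bounded_integrable.
- exact: measurable_wedge.
- exact: leb2_wedge_fin.
- by apply: measurable_funTS; exact: measurable_quad.
exists (`|q0| + `|qS| * w + `|qT| * w + `|qSS| * w ^+ 2 + `|qST| * (w * w) + `|qTT| * w ^+ 2).
split; first by rewrite num_real.
move=> M ltM p /= /andP[TS Sw]; apply: (le_trans _ (ltW ltM)).
have Tw : `|T p| <= w := ltW (lt_trans TS Sw).
have {Sw} Sw : `|S p| <= w by rewrite ger0_norm ltW // (le_lt_trans _ TS).
have wge0 := ltW w0.
have step (a b A B : R) : `|a| <= A -> `|b| <= B -> `|a + b| <= A + B.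
  by move=> aA bB; apply: (le_trans (ler_normD _ _)); exact: lerD.
have {}step := (step _ _ _ _ (step _ _ _ _ (step _ _ _ _ (step _ _ _ _
  (step _ _ _ _ _ _) _) _) _) _).
rewrite /quadratic; apply: step;
  rewrite ?normrM ?normrX ?ler_wpM2l ?lerXn2r ?nnegrE ?ler_pM //.
Qed.

(** Fubini, in the order that makes the coordinate across [d] the outer
    variable. *)
Lemma wedge_integral :
  \int[leb2]_(p in wedge o d w) quad (S p) (T p) =
  quadratic_wedge_integral w q0 qS qSS qTT.
Proof.
pose W (p : R * R) : R := if (`|T p| < S p) && (S p < w) then quad (S p) (T p) else 0.
have WE : EFin \o W = (EFin \o (fun p => quad (S p) (T p))) \_ (wedge o d w).
  apply/funext => p; rewrite patchE /W /=.
  by case: ifPn => Wp; [rewrite mem_set|rewrite memNset //; apply/negP].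
have iW : leb2.-integrable setT (EFin \o W).
  have [H _] := @integrable_mkcond _ _ _ leb2 _
    (EFin \o (fun p => quad (S p) (T p))) measurable_wedge.
  by rewrite WE; apply: H; exact: integrable_quad.
suff H : (\int[leb2]_p (W p)%:E)%E = (quadratic_wedge_integral w q0 qS qSS qTT)%:E.
  by rewrite /Rintegral integral_mkcond -WE H.
case: (dP) => -[d0 d1].
  rewrite -(iterated_wedge_integral q0 qS qT qSS qST qTT w0 o.1 o.2 d1 d1).
  rewrite -(integral12_prod_meas1 iW); apply: eq_integral => x _.
  apply: eq_integral => y _; congr EFin.
  by rewrite /W /wedge_fun /along /across d0 /= !mul0r add0r subr0.
have d1' : - d.1 = 1 \/ - d.1 = -1 by case: d1 => ->; [right|left; rewrite opprK].
rewrite -(iterated_wedge_integral q0 qS qT qSS qST qTT w0 o.2 o.1 d1' d1).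
rewrite -(integral21_prod_meas1 iW); apply: eq_integral => x _.
apply: eq_integral => y _; congr EFin.
by rewrite /W /wedge_fun /along /across d0 /= !mul0r addr0 sub0r mulNr.
Qed.

End Wedge.

(** * The triangles of the mesh *)

Section Triangles.
Context {R : realType}.
Variable n : nat.
Hypothesis n0 : (0 < n)%N.
Implicit Types (K : triangle n) (p : R * R).

Definition center_of K : R * R := let: (i, j, _) := K in cell_center n i j.

(** The direction from corner number [k] to corner number [k + 1] of the cell;
    this side lies across it at distance [mesh_half] from the centre. *)
Definition base_direction K : R * R := let: (_, k) := K in
  nth (0, 0) [:: (1, 0); (0, 1); (-1, 0); (0, -1)] k.

Definition mesh_half : R := (2 * n%:R)^-1.

Local Notation o := center_of.
Local Notation d := base_direction.
Local Notation w := mesh_half.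
Local Notation S K := (across (o K) (d K)).
Local Notation T K := (along (o K) (d K)).

Definition vtx0 := @Ordinal 3 0 isT.
Definition vtx1 := @Ordinal 3 1 isT.
Definition vtx2 := @Ordinal 3 2 isT.

Let n_neq0 : n%:R != 0 :> R. Proof. by rewrite pnatr_eq0 -lt0n. Qed.

Lemma mesh_half_gt0 : 0 < w.
Proof. by rewrite invr_gt0 mulr_gt0 ?ltr0n. Qed.

Lemma base_directionP K : axis_direction (d K).
Proof.
case: K => [[i j] [[|[|[|[|k]]]] kP]] //=; rewrite /axis_direction /=;
by [right; split; auto|left; split; auto].
Qed.

Lemma sum_ord3 (V : nmodType) (f : 'I_3 -> V) : \sum_a f a = f vtx0 + f vtx1 + f vtx2.
Proof.
rewrite !big_ord_recr big_ord0 /= add0r.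
by do !congr (_ + _); congr f; apply: val_inj.
Qed.

Lemma vertex0 K : vertex K vtx0 = o K :> R * R.
Proof. by case: K => [[i j] k]. Qed.

Lemma vertex1 K : vertex K vtx1 =
  ((o K).1 + w * ((d K).2 - (d K).1), (o K).2 - w * ((d K).1 + (d K).2)).
Proof.
case: K => [[i j] [[|[|[|[|k]]]] kP]] //=; rewrite /corner /cell_center /w /=;
  by congr (_, _); rewrite ?natrD; field.
Qed.

Lemma vertex2 K : vertex K vtx2 =
  ((o K).1 + w * ((d K).2 + (d K).1), (o K).2 + w * ((d K).2 - (d K).1)).
Proof.
case: K => [[i j] [[|[|[|[|k]]]] kP]] //=; rewrite /corner /cell_center /w /=;
  by congr (_, _); rewrite ?natrD; field.
Qed.

Lemma direction_sqr K : (d K).1 ^+ 2 + (d K).2 ^+ 2 = 1.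
Proof.
by case: (base_directionP K) => -[-> [->|->]];
  rewrite ?sqrrN expr0n expr1n ?addr0 ?add0r.
Qed.

Lemma along_across_coordinates K p :
  p = ((o K).1 + (d K).1 * T K p + (d K).2 * S K p,
       (o K).2 + (d K).2 * T K p - (d K).1 * S K p).
Proof.
rewrite /along /across; have := direction_sqr K.
case: p (o K) (d K) => x y [a b] [c s] /= H.
have E (z : R) : z = (c ^+ 2 + s ^+ 2) * z by rewrite H mul1r.
by congr (_, _); [rewrite [LHS](_ : _ = a + (x - a))|rewrite [LHS](_ : _ = b + (y - b))];
  try ring; rewrite [X in _ + X = _]E; ring.
Qed.

Definition closed_wedge K : set (R * R) := [set p | `|T K p| <= S K p <= w].

Lemma regionE K : region K = closed_wedge K.
Proof.
have w0 := mesh_half_gt0; have w_neq0 := lt0r_neq0 w0.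
apply/seteqP; split => [p [t [t0 t1 pE]]|p /= /andP[TS Sw]].
  rewrite !sum_ord3 vertex0 vertex1 vertex2 /= in t1 pE.
  have t0E : t vtx0 = 1 - t vtx1 - t vtx2 by rewrite -t1; ring.
  have SE : S K p = w * (t vtx1 + t vtx2).
    rewrite -[RHS]mul1r -(direction_sqr K) pE /across /= t0E; ring.
  have TE : T K p = w * (t vtx2 - t vtx1).
    rewrite -[RHS]mul1r -(direction_sqr K) pE /along /= t0E; ring.
  rewrite /closed_wedge /= SE TE normrM gtr0_norm // ler_pM2l //.
  rewrite ger_pMr //; have := t0 vtx0; have := t0 vtx1; have := t0 vtx2.
  by rewrite t0E ler_norml => ? ? ?; apply/andP; split; [apply/andP; split|]; lra.
exists (fun a => if a == vtx0 then 1 - S K p / w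
  else if a == vtx1 then (S K p - T K p) / (2 * w) else (S K p + T K p) / (2 * w)).
move: TS; rewrite ler_norml => /andP[TS1 TS2]; split.
- move=> a; case: ifP => _.
    by rewrite subr_ge0 ler_pdivrMr // mul1r.
  by case: ifP => _; rewrite divr_ge0 ?mulr_ge0 ?(ltW w0) //; lra.
- by rewrite sum_ord3 /=; field.
- rewrite !sum_ord3 /= vertex0 vertex1 vertex2 /= [LHS](along_across_coordinates K).
  by congr (_, _); field.
Qed.

Lemma interiorE K : (region K)° = wedge (o K) (d K) w.
Proof.
rewrite regionE; apply/seteqP; split => p.
  move=> /nbhs_box[e e0 eK].
  (* Moving across by a small h, in either direction, stays in the triangle;
     this makes both inequalities strict. *)
  have shift (h : R) : `|h| < e -> `|T K p| <= S K p + h <= w.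
    move=> he; have hd (x : R) : x = 0 \/ x = 1 \/ x = -1 -> `|h * x| < e.
      by move=> [->|[->|->]]; rewrite ?mulr0 ?mulr1 ?mulrN1 ?normrN ?normr0.
    have /= := eK (p.1 + h * (d K).2, p.2 + h * - (d K).1) _.
    rewrite /closed_wedge /=.
    have -> : T K (p.1 + h * (d K).2, p.2 + h * - (d K).1) = T K p.
      by rewrite /along /=; ring.
    have -> : S K (p.1 + h * (d K).2, p.2 + h * - (d K).1) = S K p + h.
      by rewrite -[h in RHS]mul1r -(direction_sqr K) /across /=; ring.
    apply; split; rewrite /= in_itv /= -ltr_distl addrC addKr; apply: hd;
      case: (base_directionP K) => -[e1 [e2|e2]];
      rewrite ?e1 ?e2 ?oppr0 ?opprK; auto.
  have := shift (e / 2); have := shift (- (e / 2)).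
  rewrite normrN gtr0_norm ?divr_gt0 // /wedge /=.
  move=> /(_ ltac:(lra))/andP[h1 _] /(_ ltac:(lra))/andP[_ h2].
  by apply/andP; split; lra.
move=> /andP[TS Sw].
have cS : {for p, continuous (S K)}.
  by apply: cvgB; apply: cvgM; try exact: cvg_cst; apply: cvgB;
   [exact: cvg_fst|exact: cvg_cst|exact: cvg_snd|exact: cvg_cst].
have cT : {for p, continuous (T K)}.
  by apply: cvgD; apply: cvgM; try exact: cvg_cst; apply: cvgB;
   [exact: cvg_fst|exact: cvg_cst|exact: cvg_snd|exact: cvg_cst].
have cTS : {for p, continuous (fun q => S K q - `|T K q|)}.
  by apply: cvgB => //; apply: cvg_norm.
have n1 := cvgr_lt _ cS _ Sw.
have n2 : \forall q \near p, 0 < S K q - `|T K q|.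
  by apply: (cvgr_gt _ cTS); rewrite subr_gt0.
rewrite /interior /=; near=> q; rewrite /closed_wedge /=; apply/andP; split.
  by rewrite -subr_ge0 ltW //; near: q; exact: n2.
by rewrite ltW //; near: q; exact: n1.
Unshelve. all: by end_near. Qed.

End Triangles.

(** * The element stiffness matrix *)

(** Weights and linear forms of the six squares in the element energy. *)
Definition energy_weight {F : fieldType} (m : 'I_6) : F :=
  nth 0 [:: 6^-1; 3^-1; 4 / 3; 6^-1; 3^-1; 4 / 3] m.

Definition energy_mode {F : fieldType} (c a b p q r : F) (m : 'I_6) : F :=
  nth 0 [:: a - c; a + c - 2 * p; r - q; b - c; b + c - 2 * q; r - p] m.

Lemma element_energy_modes (F : numFieldType) (sigma : {rmorphism F -> F})
    (c a b p q r : F) :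
  element_energy sigma c a b p q r =
  \sum_m energy_weight m *
     (sigma (energy_mode c a b p q r m) * energy_mode c a b p q r m).
Proof.
rewrite !big_ord_recr big_ord0 /= /energy_weight /energy_mode /= /element_energy.
by field.
Qed.

Section LocalStiffness.
Context {R : realType}.
Variable n : nat.
Hypothesis n0 : (0 < n)%N.
Implicit Types (K : triangle n) (p : R * R).
Local Notation o := center_of.
Local Notation d := base_direction.
Local Notation w := (mesh_half n).
Local Notation S K := (across (o K) (d K)).
Local Notation T K := (along (o K) (d K)).
Local Notation leb2 := (@leb2 R).

(** The nodes in the order of the arguments of the element forms: the centre,
    the two corners, and the midpoints of the edges opposite to the second
    corner, the first corner and the centre. *)
Definition at_nodes {F : Type} {A} (form : F -> F -> F -> F -> F -> F -> A) K
    (f : R * R -> F) : A :=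
  form (f (vertex K vtx0)) (f (vertex K vtx1)) (f (vertex K vtx2))
    (f (edge_midpoint K vtx0 vtx1)) (f (edge_midpoint K vtx0 vtx2))
    (f (edge_midpoint K vtx1 vtx2)).

Lemma quadratic_on_wedge K (f : R * R -> R) : quadratic_on (region K) f ->
  exists q0 qS qT qSS qST qTT : R, forall p, region K p ->
    f p = quadratic q0 qS qT qSS qST qTT (S K p) (T K p).
Proof.
move=> [c0 [c1 [c2 [c3 [c4 [c5 fE]]]]]].
(* Coefficients after substituting x = a + c T + s S and y = b + s T - c S. *)
have H := @along_across_coordinates R n K.
pose a := (o K).1 : R; pose b := (o K).2 : R.
pose c := (d K).1 : R; pose s := (d K).2 : R.
exists (c0 + c1 * a + c2 * b + c3 * a ^+ 2 + c4 * (a * b) + c5 * b ^+ 2).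
exists (c1 * s - c2 * c + 2 * c3 * a * s + c4 * (b * s - a * c) - 2 * c5 * b * c).
exists (c1 * c + c2 * s + 2 * c3 * a * c + c4 * (b * c + a * s) + 2 * c5 * b * s).
exists (c3 * s ^+ 2 - c4 * (s * c) + c5 * c ^+ 2).
exists (2 * c3 * (c * s) + c4 * (s ^+ 2 - c ^+ 2) - 2 * c5 * (c * s)).
exists (c3 * c ^+ 2 + c4 * (c * s) + c5 * s ^+ 2).
move=> p pK; rewrite fE //.
have H1 : p.1 = a + c * T K p + s * S K p by exact: (congr1 fst (H p)).
have H2 : p.2 = b + s * T K p - c * S K p by exact: (congr1 snd (H p)).
by rewrite H1 H2 /quadratic; ring.
Qed.

Lemma at_nodes_quadratic {A} (form : R -> R -> R -> R -> R -> R -> A) K f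
    (q0 qS qT qSS qST qTT : R) :
  let q := quadratic q0 qS qT qSS qST qTT in
  (forall p, region K p -> f p = q (S K p) (T K p)) ->
  at_nodes form K f =
  form (q 0 0) (q w (- w)) (q w w) (q (w / 2) (- w / 2)) (q (w / 2) (w / 2)) (q w 0).
Proof.
move=> q fE; have w0 := mesh_half_gt0 (R := R) n0.
have val p x y : S K p = x -> T K p = y -> `|y| <= x <= w -> f p = q x y.
  by move=> <- <- xy; apply: fE; rewrite regionE.
have dir := direction_sqr K.
have SE (x y : R) : S K ((o K).1 + x, (o K).2 + y) = (d K).2 * x - (d K).1 * y.
  by rewrite /across /=; ring.
have TE (x y : R) : T K ((o K).1 + x, (o K).2 + y) = (d K).1 * x + (d K).2 * y.
  by rewrite /along /=; ring.
have pt x y p : `|y| <= x <= w ->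
   p = ((o K).1 + ((d K).2 * x + (d K).1 * y), (o K).2 + ((d K).2 * y - (d K).1 * x)) ->
   f p = q x y.
  move=> xy ->; apply: val => //.
    by rewrite SE -[RHS]mul1r -dir; ring.
  by rewrite TE -[RHS]mul1r -dir; ring.
have w2 : w / 2 = w * 2^-1 by [].
rewrite /at_nodes /edge_midpoint vertex0 vertex1 // vertex2 //.
rewrite (pt 0 0) ?normr0 ?lexx ?ltW //; last first.
  by rewrite [LHS]surjective_pairing; congr (_, _); ring.
rewrite (pt w (- w)) ?normrN ?gtr0_norm ?lexx //; last by congr (_, _); ring.
rewrite (pt w w) ?gtr0_norm ?lexx //; last by congr (_, _); ring.
rewrite (pt (w / 2) (- w / 2)); first last.
- by congr (_, _) => /=; field.
- by rewrite mulNr normrN gtr0_norm ?divr_gt0 // lexx; lra.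
rewrite (pt (w / 2) (w / 2)); first last.
- by congr (_, _) => /=; field.
- by rewrite gtr0_norm ?divr_gt0 // lexx; lra.
rewrite (pt w 0) //; first last.
- by congr (_, _) => /=; field.
- by rewrite normr0 lexx ltW.
Qed.

Lemma derive1_quadratic_fun (f : R -> R) (x o1 a b e g q0 qS qT qSS qST qTT : R) :
  (\forall z \near x, f z =
     quadratic q0 qS qT qSS qST qTT (a * (z - o1) + e) (b * (z - o1) + g)) ->
  let s := a * (x - o1) + e in let t := b * (x - o1) + g in
  derive1 f x = a * (qS + 2 * qSS * s + qST * t) + b * (qT + qST * s + 2 * qTT * t).
Proof.
move=> fE; pose Y : {poly R} := 'X - o1%:P.
pose PS := a *: Y + e%:P; pose PT := b *: Y + g%:P.
pose P := q0%:P + qS *: PS + qT *: PT + qSS *: PS ^+ 2 + qST *: (PS * PT)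
  + qTT *: PT ^+ 2.
have -> : derive1 f x = derive1 (horner P) x.
  rewrite !derive1E; apply: near_eq_derive.
  near=> z; rewrite (near fE z _) //.
  by rewrite /P /PS /PT /Y /quadratic !hornerE /=; ring.
rewrite -derivE /= /P /PS /PT /Y !poly.derivE; rewrite !hornerE /=.
by ring.
Unshelve. all: by end_near. Qed.

Lemma partials_quadratic K f (q0 qS qT qSS qST qTT : R) p :
  (forall p, region K p -> f p = quadratic q0 qS qT qSS qST qTT (S K p) (T K p)) ->
  (region K)° p ->
  let DS := qS + 2 * qSS * S K p + qST * T K p in
  let DT := qT + qST * S K p + 2 * qTT * T K p in
  partial1 f p = (d K).2 * DS + (d K).1 * DT /\
  partial2 f p = - (d K).1 * DS + (d K).2 * DT.
Proof.
move=> fE pK; have /nbhs_box[e e0 eK] : nbhs p (region K) := pK.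
split.
  rewrite /partial1 (@derive1_quadratic_fun _ _ (o K).1 (d K).2 (d K).1
    (- ((d K).1 * (p.2 - (o K).2))) ((d K).2 * (p.2 - (o K).2)) q0 qS qT qSS qST qTT).
    by rewrite /across /along.
  near=> z; rewrite fE //; apply: eK; split => /=; last by rewrite in_itv /=; lra.
  by rewrite in_itv /= -ltr_distlC; near: z; exact: nbhsx_ballx.
rewrite /partial2 (@derive1_quadratic_fun _ _ (o K).2 (- (d K).1) (d K).2
  ((d K).2 * (p.1 - (o K).1)) ((d K).1 * (p.1 - (o K).1)) q0 qS qT qSS qST qTT).
  by rewrite /across /along; ring.
near=> z; rewrite fE.
  by rewrite /across /along /=; congr quadratic; ring.
apply: eK; split => /=; first by rewrite in_itv /=; lra.
by rewrite in_itv /= -ltr_distlC; near: z; exact: nbhsx_ballx.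
Unshelve. all: by end_near. Qed.

(** In the coordinates [S] and [T], which are orthonormal, the gradients are
    affine and their product is a quadratic function, with the integral known.
    Both sides are then bilinear in the coefficients of [f] and [g]. *)
Lemma local_stiffness K (f g : R * R -> R) :
  quadratic_on (region K) f -> quadratic_on (region K) g ->
  \int[leb2]_(p in (region K)°)
     (partial1 f p * partial1 g p + partial2 f p * partial2 g p) =
  \sum_m energy_weight m *
    (at_nodes energy_mode K f m * at_nodes energy_mode K g m).
Proof.
move=> /quadratic_on_wedge[q0 [qS [qT [qSS [qST [qTT fE]]]]]].
move=> /quadratic_on_wedge[r0 [rS [rT [rSS [rST [rTT gE]]]]]].
rewrite (at_nodes_quadratic _ fE) (at_nodes_quadratic _ gE).
transitivity (\int[leb2]_(p in wedge (o K) (d K) w)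
   quadratic (qS * rS + qT * rT)
     (2 * (qS * rSS + qSS * rS) + (qT * rST + qST * rT))
     ((qS * rST + qST * rS) + 2 * (qT * rTT + qTT * rT))
     (4 * (qSS * rSS) + qST * rST)
     (2 * (qSS * rST + qST * rSS) + 2 * (qST * rTT + qTT * rST))
     (qST * rST + 4 * (qTT * rTT)) (S K p) (T K p)).
  rewrite -interiorE //; apply: eq_Rintegral => p; rewrite inE => pK.
  have [-> ->] := partials_quadratic fE pK.
  have [-> ->] := partials_quadratic gE pK.
  rewrite /quadratic; move: (S K p) (T K p) => s t.
  have := @direction_sqr R n K; move: (d K) => [c e] /= H.
  have E z : z = (c ^+ 2 + e ^+ 2) * z by rewrite H mul1r.
  by rewrite [RHS]E; ring.
rewrite wedge_integral; last 2 first.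
- exact: mesh_half_gt0.
- exact: base_directionP.
rewrite !big_ord_recr big_ord0 /= /energy_weight /energy_mode /=.
by rewrite /quadratic /quadratic_wedge_integral; field.
Qed.

End LocalStiffness.

(** * Counting the nodes *)

Lemma ler_sum_injective (F : numDomainType) (I J : finType) (T : eqType)
    (x : I -> T) (y : J -> T) (g : T -> F) :
  injective x -> (forall t, 0 <= g t) ->
  (forall i, g (x i) != 0 -> exists j, y j = x i) ->
  \sum_i g (x i) <= \sum_j g (y j).
Proof.
move=> xinj g0 xy.
apply: (@le_trans _ _ (\sum_i \sum_j (if y j == x i then g (y j) else 0))).
  apply: ler_sum => i _; have [->|/xy[j yj]] := eqVneq (g (x i)) 0.
    by apply: sumr_ge0 => j _; case: ifP.
  rewrite (bigD1 j) //= yj eqxx lerDl.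
  by apply: sumr_ge0 => k _; case: ifP.
rewrite exchange_big; apply: ler_sum => j _.
have [/existsP[i /eqP yi]|/existsPn none] := boolP [exists i, y j == x i].
  rewrite (bigD1 i) //= yi eqxx big1 ?addr0 // => k ki.
  by case: eqP => // /xinj ik; rewrite ik eqxx in ki.
by rewrite big1 // => i _; rewrite (negPf (none i)).
Qed.

Lemma sum_shift (V : nmodType) n (f : nat -> V) : f 0%N = 0 -> f n = 0 ->
  \sum_(i < n) f i.+1 = \sum_(i < n) f i.
Proof.
move=> f0 fn; have := erefl (\sum_(i < n.+1) f i).
by rewrite {1}big_ord_recl big_ord_recr /= f0 fn add0r addr0.
Qed.

Section Lattice.
Context {R : realType}.
Variable n : nat.
Hypothesis n0 : (0 < n)%N.

(** Vertices and edge midpoints lie on the grid of step [1 / (4 n)]. *)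
Definition lattice_point (a b : nat) : R * R :=
  (a%:R / (4 * n%:R), b%:R / (4 * n%:R)).

(** Position, within the cell, of node [l] of the triangle [k]; the nodes are
    numbered as in [at_nodes]. *)
Definition lattice_offset (k l : nat) : nat * nat :=
  nth (0, 0)%N (nth [::]
   [:: [:: (2, 2); (0, 0); (4, 0); (1, 1); (3, 1); (2, 0)];
       [:: (2, 2); (4, 0); (4, 4); (3, 1); (3, 3); (4, 2)];
       [:: (2, 2); (4, 4); (0, 4); (3, 3); (1, 3); (2, 4)];
       [:: (2, 2); (0, 4); (0, 0); (1, 3); (1, 1); (0, 2)]]%N k) l.

Definition lattice_node (i j k l : nat) : R * R :=
  lattice_point (4 * i + (lattice_offset k l).1) (4 * j + (lattice_offset k l).2).

Let n_neq0 : n%:R != 0 :> R. Proof. by rewrite pnatr_eq0 -lt0n. Qed.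

Lemma nodesE (K : triangle n) : let: (i, j, k) := K in
  [/\ vertex K vtx0 = lattice_node i j k 0, vertex K vtx1 = lattice_node i j k 1,
      vertex K vtx2 = lattice_node i j k 2 &
  [/\ edge_midpoint K vtx0 vtx1 = lattice_node i j k 3,
      edge_midpoint K vtx0 vtx2 = lattice_node i j k 4 &
      edge_midpoint K vtx1 vtx2 = lattice_node i j k 5]].
Proof.
case: K => [[i j] [[|[|[|[|k]]]] kP]] //; do !split;
rewrite /edge_midpoint /lattice_node /lattice_point /= /corner /cell_center /= ?natrD ?natrM;
by congr (_, _); field.
Qed.

Lemma at_nodesE (F : Type) (A : Type) (form : F -> F -> F -> F -> F -> F -> A)
    (K : triangle n) (f : R * R -> F) : let: (i, j, k) := K in
  let P l := f (lattice_node i j k l) in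
  at_nodes form K f = form (P 0%N) (P 1%N) (P 2%N) (P 3%N) (P 4%N) (P 5%N).
Proof.
case: K => [[i j] k]; have [h0 h1 h2 [h3 h4 h5]] := nodesE (i, j, k).
by rewrite /at_nodes h0 h1 h2 h3 h4 h5.
Qed.

Lemma lattice_point_inj a b a' b' :
  lattice_point a b = lattice_point a' b' -> a = a' /\ b = b'.
Proof.
have c0 : (4 * n%:R)^-1 != 0 :> R by rewrite invr_eq0 mulf_neq0 // pnatr_eq0.
by case=> /(mulIf c0)/eqP + /(mulIf c0)/eqP; rewrite !eqr_nat => /eqP-> /eqP->.
Qed.

Lemma lattice_point_square a b : (a <= 4 * n)%N -> (b <= 4 * n)%N ->
  square (lattice_point a b).
Proof.
have c0 : 0 < 4 * n%:R :> R by rewrite mulr_gt0 ?ltr0n.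
move=> an bn; split; rewrite /= in_itv /= divr_ge0 ?(ltW c0) //;
  by rewrite ler_pdivrMr // mul1r -natrM ler_nat.
Qed.

Lemma lattice_point_boundary a b :
  [|| a == 0%N, b == 0%N, a == (4 * n)%N | b == (4 * n)%N] ->
  ~ open_square (lattice_point a b).
Proof.
have c0 : 4 * n%:R != 0 :> R by rewrite mulf_neq0 // pnatr_eq0.
move=> h [/= ]; rewrite !in_itv /= => /andP[a1 a2] /andP[b1 b2].
case/or4P: h => /eqP E; move: a1 a2 b1 b2; rewrite E ?mul0r ?ltxx //;
by rewrite natrM divff // ltxx.
Qed.

Section Functions.
Variables (F : numFieldType) (u : R * R -> F).
Hypothesis u_bd : forall p, square p -> ~ open_square p -> u p = 0.

Let U a b := u (lattice_point a b).

Let U_bd a b : (a <= 4 * n)%N -> (b <= 4 * n)%N ->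
  [|| a == 0%N, b == 0%N, a == (4 * n)%N | b == (4 * n)%N] -> U a b = 0.
Proof.
by move=> an bn bd; apply: u_bd;
  [exact: lattice_point_square|exact: lattice_point_boundary].
Qed.

(** In each row of cells the value 0 travels to the right: from the left side
    of the square to the centre of the first cell, from the centre of a cell to
    the lower end of its right side, from there to the centre of the next
    cell. *)
Lemma nodal_values_eq0 :
  (forall K : triangle n,
    at_nodes (fun c a b p q r : F =>
      [/\ a = c, b = c & c = 0 -> [/\ p = 0, q = 0 & r = 0]]) K u) ->
  forall p, interior_nodes n p -> u p = 0.
Proof.
move=> H.
have cell (i j : 'I_n) (k : 'I_4) := H (i, j, k).
have centre i : forall j, (i < n)%N -> (j < n)%N -> U (4 * i + 2) (4 * j + 2) = 0.
  elim: i => [|i IH] j i_n j_n.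
    have := cell (Ordinal i_n) (Ordinal j_n) (@Ordinal 4 3 isT).
    rewrite (at_nodesE _ (_, _, _)) /lattice_node /= => -[H1 _ _].
    by apply: (etrans (esym H1)); apply: U_bd; rewrite ?muln0 //; lia.
  have := cell (Ordinal (ltnW i_n)) (Ordinal j_n) (@Ordinal 4 1 isT).
  rewrite (at_nodesE _ (_, _, _)) /lattice_node /= => -[H1 _ _].
  apply: etrans (IH j (ltnW i_n) j_n); apply: etrans H1.
  have := cell (Ordinal i_n) (Ordinal j_n) (@Ordinal 4 3 isT).
  rewrite (at_nodesE _ (_, _, _)) /lattice_node /= => -[_ H2 _].
  by apply: (etrans (esym H2)); rewrite !addn0 mulnS addnC.
move=> p [_ [[[i j] k]]] [a [b ->]].
have u0 : u (vertex (i, j, k) vtx0) = 0.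
  have [-> _ _ _] := nodesE (i, j, k); rewrite /lattice_node.
  by apply: etrans (centre i j _ _) => //; case: (k) => -[|[|[|[|]]]].
have := H (i, j, k); rewrite /at_nodes u0 => -[u1 u2 /(_ erefl)[u01 u02 u12]].
have E c : edge_midpoint (i, j, k) c c = vertex (i, j, k) c :> R * R.
  by rewrite /edge_midpoint [RHS]surjective_pairing; congr (_, _); field.
have Ec a' b' : edge_midpoint (i, j, k) a' b' = edge_midpoint (i, j, k) b' a' :> R * R.
  by rewrite /edge_midpoint addrC [X in (_, X / _)]addrC.
have o3 e : [\/ e = vtx0, e = vtx1 | e = vtx2].
  by case: e => -[|[|[|?]]] ? //; [constructor 1|constructor 2|constructor 3]; apply: val_inj.
case: (o3 a) => ->; case: (o3 b) => ->; rewrite ?E //; by rewrite Ec.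
Qed.

(** Each cell owns its centre, its lower left corner, the midpoints of its four
    half-diagonals and of its lower and left sides.  This lists every node
    once, and some boundary points. *)
Definition own_offset (l : 'I_8) : nat * nat :=
  nth (0, 0)%N [:: (2, 2); (0, 0); (1, 1); (3, 1); (3, 3); (1, 3); (2, 0); (0, 2)]%N l.

Definition own_node (x : 'I_n * 'I_n * 'I_8) : R * R :=
  let: (i, j, l) := x in
  lattice_point (4 * i + (own_offset l).1) (4 * j + (own_offset l).2).

Lemma own_offset_lt l : ((own_offset l).1 < 4)%N && ((own_offset l).2 < 4)%N.
Proof. by case: l => -[|[|[|[|[|[|[|[|l]]]]]]]]. Qed.

Lemma own_node_inj : injective own_node.
Proof.
move=> [[i j] l] [[i' j'] l'] /lattice_point_inj[e1 e2].
have /andP[l1 l2] := own_offset_lt l; have /andP[l1' l2'] := own_offset_lt l'.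
have ii : i = i' by apply: val_inj => /=; lia.
have jj : j = j' by apply: val_inj => /=; lia.
have ll : own_offset l = own_offset l'.
  by rewrite [LHS]surjective_pairing [RHS]surjective_pairing; congr (_, _); lia.
have : (own_offset l == own_offset l') = (l == l' :> nat).
  by apply: nth_uniq; [exact: ltn_ord|exact: ltn_ord|].
by rewrite ll eqxx ii jj => /esym/eqP/val_inj->.
Qed.

Lemma own_node_interior x : open_square (own_node x) -> interior_nodes n (own_node x).
Proof.
move=> ox; split => //; case: x {ox} => [[i j] l].
have N k := nodesE (i, j, k); rewrite /own_node.
pose k0 := @Ordinal 4 0 isT; pose k1 := @Ordinal 4 1 isT.
pose k2 := @Ordinal 4 2 isT; pose k3 := @Ordinal 4 3 isT.
have E k c : edge_midpoint (i, j, k) c c = vertex (i, j, k) c :> R * R.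
  by rewrite /edge_midpoint [RHS]surjective_pairing; congr (_, _); field.
case: l => -[|[|[|[|[|[|[|[|l]]]]]]]] lP //.
- by exists (i, j, k0), vtx0, vtx0; rewrite E; have [-> _ _ _] := N k0.
- by exists (i, j, k0), vtx1, vtx1; rewrite E; have [_ -> _ _] := N k0.
- by exists (i, j, k0), vtx0, vtx1; have [_ _ _ [-> _ _]] := N k0.
- by exists (i, j, k1), vtx0, vtx1; have [_ _ _ [-> _ _]] := N k1.
- by exists (i, j, k2), vtx0, vtx1; have [_ _ _ [-> _ _]] := N k2.
- by exists (i, j, k3), vtx0, vtx1; have [_ _ _ [-> _ _]] := N k3.
- by exists (i, j, k0), vtx1, vtx2; have [_ _ _ [_ _ ->]] := N k0.
- by exists (i, j, k3), vtx1, vtx2; have [_ _ _ [_ _ ->]] := N k3.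
Qed.

Variable sigma : {rmorphism F -> F}.
Local Notation sq x := (sigma x * x).

(** The nodes on the upper and right sides of the cells can be exchanged for
    those on the lower and left sides, because [u] vanishes on the boundary.
    Then each node owned by a cell has received [32/3]. *)
Lemma sum_element_mass :
  \sum_(K : triangle n) at_nodes (element_mass sigma) K u =
  32 / 3 * \sum_(x : 'I_n * 'I_n * 'I_8) sq (u (own_node x)).
Proof.
pose G a b := sq (U a b).
have G_bd a b : (a <= 4 * n)%N -> (b <= 4 * n)%N ->
    [|| a == 0%N, b == 0%N, a == (4 * n)%N | b == (4 * n)%N] -> G a b = 0.
  by move=> an bn bd; rewrite /G U_bd // mulr0.
pose cells (f : nat -> nat -> F) := \sum_(i < n) \sum_(j < n) f i j.
pose C a b := cells (fun i j => G (4 * i + a) (4 * j + b)).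
have cellsD f g : cells (fun i j => f i j + g i j) = cells f + cells g.
  by rewrite /cells -big_split; apply: eq_bigr => i _; rewrite -big_split.
have cellsZ c f : cells (fun i j => c * f i j) = c * cells f.
  by rewrite /cells mulr_sumr; apply: eq_bigr => i _; rewrite mulr_sumr.
have sum_pairs (m : nat) (f : 'I_n * 'I_n * 'I_m -> F) :
    \sum_x f x = \sum_(i < n) \sum_(j < n) \sum_(k < m) f (i, j, k).
  rewrite (eq_bigr (fun x => f (x.1, x.2))) => [|[] //].
  rewrite -(pair_bigA _ (fun x k => f (x, k))) /=.
  rewrite (eq_bigr (fun x => \sum_k f ((x.1, x.2), k))) => [|[] //].
  by rewrite -(pair_bigA _ (fun i j => \sum_k f ((i, j), k))).
have shift1 b : (b <= 4)%N -> C 4 b = C 0%N b.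
  move=> b4; rewrite /C /cells exchange_big [RHS]exchange_big.
  apply: eq_bigr => j _; have jn := ltn_ord j.
  rewrite -(@sum_shift _ n (fun i => G (4 * i + 0)%N (4 * j + b)%N)).
  - by apply: eq_bigr => i _; congr G; lia.
  - by apply: G_bd; rewrite ?muln0 ?addn0 ?eqxx //; lia.
  - by apply: G_bd; rewrite ?addn0 ?eqxx ?orbT //; lia.
have shift2 a : (a <= 4)%N -> C a 4 = C a 0%N.
  move=> a4; apply: eq_bigr => i _; have iin := ltn_ord i.
  rewrite -(@sum_shift _ n (fun j => G (4 * i + a)%N (4 * j + 0)%N)).
  - by apply: eq_bigr => j _; congr G; lia.
  - by apply: G_bd; rewrite ?muln0 ?addn0 ?eqxx ?orbT //; lia.
  - by apply: G_bd; rewrite ?addn0 ?eqxx ?orbT //; lia.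
have -> : \sum_(x : 'I_n * 'I_n * 'I_8) sq (u (own_node x)) =
    C 2 2 + C 0 0 + C 1 1 + C 3 1 + C 3 3 + C 1 3 + C 2 0 + C 0 2.
  rewrite sum_pairs /C -!cellsD; apply: eq_bigr => i _; apply: eq_bigr => j _.
  by rewrite big_ord8.
have -> : \sum_(K : triangle n) at_nodes (element_mass sigma) K u =
    32 / 3 * C 2 2 + 8 / 3 * (C 0 0 + C 4 0 + C 4 4 + C 0 4)
    + 32 / 3 * (C 1 1 + C 3 1 + C 3 3 + C 1 3)
    + 16 / 3 * (C 2 0 + C 4 2 + C 2 4 + C 0 2).
  rewrite sum_pairs /C -!cellsD -!cellsZ -!cellsD.
  apply: eq_bigr => i _; apply: eq_bigr => j _.
  rewrite !big_ord_recr big_ord0 /= add0r !(at_nodesE _ (_, _, _)) /element_mass /G /U.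
  by rewrite /lattice_node /=; field.
rewrite !shift1 // !shift2 // ?shift1 //.
by field.
Qed.

End Functions.
End Lattice.

(** * The stiffness matrix *)

Section Stiffness.
Context {R : realType}.
Local Notation C := R[i].
Local Notation "x %:C" := (real_complex R x).
Variable n : nat.
Hypothesis n0 : (0 < n)%N.
Variable phi : 'I_(ndof n) -> R * R -> R.
Hypothesis phi_basis : nodal_basis phi.
Implicit Types (mu : R * R -> R) (v : 'cV[C]_(ndof n)) (K : triangle n).

Definition interpolant v (p : R * R) : C := \sum_j v j 0 * (phi j p)%:C.

Let phi_P2 i : P2_space n (phi i).
Proof. by have [node [_ _ H _]] := phi_basis. Qed.

Let sq_ge0 (x : C) : 0 <= Num.conj x * x.
Proof. by rewrite mulrC mul_conjC_ge0. Qed.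

Let sq_eq0 (x : C) : Num.conj x * x = 0 -> x = 0.
Proof. by move=> /eqP; rewrite mulrC mul_conjC_eq0 => /eqP. Qed.

Let conj_real (x : R) : (x%:C)^* = x%:C.
Proof. by apply: conj_Creal; apply/complex_realP; exists x. Qed.

Lemma AxE mu i j : Ax phi mu i j =
  \sum_(K : triangle n) (mu (barycenter K))%:C * \sum_m energy_weight m *
    ((at_nodes energy_mode K (phi j) m)%:C * (at_nodes energy_mode K (phi i) m)%:C).
Proof.
rewrite mxE mxE rmorph_sum; apply: eq_bigr => K _.
have [_ /(_ K) qi _] := phi_P2 i; have [_ /(_ K) qj _] := phi_P2 j.
rewrite rmorphM local_stiffness // rmorph_sum; congr (_ * _).
apply: eq_bigr => m _; rewrite !rmorphM; congr (_ * _).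
by case: m => -[|[|[|[|[|[|m]]]]]] mP //=;
  rewrite /energy_weight /= ?rmorphM ?fmorphV ?rmorph_nat.
Qed.

Lemma Ax_hermitian mu : Ax phi mu \is hermsymmx.
Proof.
apply/is_hermitianmxP; rewrite expr0 scale1r; apply/matrixP => i j.
have -> : ((Ax phi mu)^t*) i j = (Ax phi mu j i)^* by rewrite !mxE.
have -> : (Ax phi mu j i)^* = Ax phi mu j i.
  by rewrite mxE conj_real.
rewrite !AxE; apply: eq_bigr => K _; congr (_ * _); apply: eq_bigr => m _.
by rewrite [X in _ * X]mulrC.
Qed.

Lemma mode_interpolant v K m :
  at_nodes energy_mode K (interpolant v) m =
  \sum_j v j 0 * (at_nodes energy_mode K (phi j) m)%:C.
Proof.
rewrite /at_nodes /energy_mode /interpolant.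
by case: m => -[|[|[|[|[|[|m]]]]]] mP //=;
  rewrite ?mulr_sumr -?big_split -?sumrN -?big_split; apply: eq_bigr => j _;
  rewrite /= ?(rmorphB, rmorphD, rmorphM, rmorph_nat) /=; ring.
Qed.

Lemma hform_Ax mu v : hform (Ax phi mu) v =
  \sum_(K : triangle n) (mu (barycenter K))%:C *
    at_nodes (element_energy Num.conj) K (interpolant v).
Proof.
rewrite hformE.
transitivity (\sum_i \sum_j \sum_(K : triangle n) \sum_m
    (mu (barycenter K))%:C * (energy_weight m *
    ((v i 0)^* * (at_nodes energy_mode K (phi i) m)%:C *
     (v j 0 * (at_nodes energy_mode K (phi j) m)%:C)))).
  apply: eq_bigr => i _; apply: eq_bigr => j _; rewrite AxE mulr_sumr mulr_suml.
  apply: eq_bigr => K _; rewrite !mulr_sumr mulr_suml; apply: eq_bigr => m _.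
  by ring.
under eq_bigr do rewrite exchange_big /=.
rewrite exchange_big; apply: eq_bigr => K _ /=.
under eq_bigr do rewrite exchange_big /=.
rewrite exchange_big /at_nodes element_energy_modes mulr_sumr.
apply: eq_bigr => m _ /=.
have := mode_interpolant v K m; rewrite /at_nodes => ->.
rewrite rmorph_sum big_distrlr /= !mulr_sumr; apply: eq_bigr => i _.
rewrite !mulr_sumr; apply: eq_bigr => j _.
by rewrite rmorphM /= conj_real.
Qed.

Lemma interpolant_boundary v p : square p -> ~ open_square p -> interpolant v p = 0.
Proof.
move=> ps pb; rewrite /interpolant big1 // => j _.
by have [_ _ ->] := phi_P2 j; rewrite ?mulr0.
Qed.

Lemma interpolant_nodes v : exists node : 'I_(ndof n) -> R * R,
  [/\ injective node, range node = interior_nodes n &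
    forall i, interpolant v (node i) = v i 0].
Proof.
have [node [inj rng _ H]] := phi_basis; exists node; split=> // i.
rewrite /interpolant (bigD1 i) //= H eqxx mulr1 big1 ?addr0 // => j ji.
by rewrite H (negPf ji) mulr0.
Qed.

Lemma interpolant_eq0 v :
  (forall p, interior_nodes n p -> interpolant v p = 0) -> v = 0.
Proof.
move=> H; have [node [_ rng vE]] := interpolant_nodes v.
apply/matrixP => i j; rewrite ord1 mxE -vE; apply: H; rewrite -rng.
by exists i.
Qed.

Lemma energy_ge0 v K : 0 <= at_nodes (element_energy Num.conj) K (interpolant v).
Proof. exact: element_energy_ge0. Qed.

Lemma gap_ge0 v K : 0 <= at_nodes (element_gap Num.conj) K (interpolant v).
Proof. exact: element_gap_ge0. Qed.

Lemma sum_mass_le v :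
  \sum_(K : triangle n) at_nodes (element_mass Num.conj) K (interpolant v)
  <= 32 / 3 * sqnorm v.
Proof.
rewrite (sum_element_mass n0 (interpolant_boundary v)).
apply: ler_wpM2l; first by rewrite mulr_ge0 ?invr_ge0.
have [node [inj rng vE]] := interpolant_nodes v.
rewrite sqnormE -(eq_bigr _ (fun i _ => congr1 (fun z => z^* * z) (vE i))).
apply: (@ler_sum_injective _ _ _ _ (@own_node R n) node
  (fun p => Num.conj (interpolant v p) * interpolant v p)) => //.
  exact: own_node_inj.
move=> x xv; have : interior_nodes n (own_node x : R * R).
  apply: own_node_interior => //; apply: contrapT => xo; move/eqP: xv; apply.
  have xs : square (own_node x : R * R).
    case: x {xo} => [[i j] l] /=; have /andP[? ?] := own_offset_lt l.
    have := ltn_ord i; have := ltn_ord j => ? ?.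
    by apply: lattice_point_square => //; lia.
  by rewrite interpolant_boundary // mulr0.
by rewrite -rng => -[j _ ?]; exists j.
Qed.

Lemma hform_Ax_ge0 mu v : (forall K, 0 <= mu (barycenter K)) -> 0 <= hform (Ax phi mu) v.
Proof.
move=> mu0; rewrite hform_Ax; apply: sumr_ge0 => K _.
by rewrite mulr_ge0 ?ler0c ?energy_ge0.
Qed.

Lemma le_hform_Ax f g v : (forall K, f (barycenter K) <= g (barycenter K)) ->
  hform (Ax phi f) v <= hform (Ax phi g) v.
Proof.
move=> fg; rewrite !hform_Ax; apply: ler_sum => K _.
by rewrite ler_wpM2r ?energy_ge0 ?lecR.
Qed.

(** If the form vanished, so would the energy of the interpolant on every
    triangle. *)
Lemma hform_Ax_gt0 mu v : (forall K, 0 < mu (barycenter K)) -> v != 0 ->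
  0 < hform (Ax phi mu) v.
Proof.
move=> mu0 v0; rewrite lt_neqAle hform_Ax_ge0 ?andbT; last by move=> K; exact: ltW.
apply: contraNneq v0 => /esym; rewrite hform_Ax => /psumr_eq0P H; apply/eqP.
apply: interpolant_eq0; apply: nodal_values_eq0 => //; first exact: interpolant_boundary.
move=> K; have /H/(_ K isT)/eqP : forall K, true -> 0 <= (mu (barycenter K))%:C *
    at_nodes (element_energy Num.conj) K (interpolant v).
  by move=> K' _; rewrite mulr_ge0 ?energy_ge0 ?ler0c ?ltW.
rewrite mulf_eq0 => /orP[/eqP/complexI/eqP|/eqP]; first by rewrite gt_eqF.
exact: element_energy_eq0.
Qed.

(** With equality, the gap of the interpolant would vanish on every triangle. *)
Lemma hform_Ax_lt mu (M : R) v : 0 < M -> (forall K, mu (barycenter K) <= M) -> v != 0 ->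
  hform (Ax phi mu) v < (32 / 3 * M)%:C * sqnorm v.
Proof.
move=> M0 muM v0.
have sumE : \sum_(K : triangle n) at_nodes (element_energy Num.conj) K (interpolant v)
  + \sum_(K : triangle n) at_nodes (element_gap Num.conj) K (interpolant v)
  = \sum_(K : triangle n) at_nodes (element_mass Num.conj) K (interpolant v).
  by rewrite -big_split; apply: eq_bigr => K _; exact: element_energyD_gap.
apply: (@le_lt_trans _ _ (M%:C * \sum_(K : triangle n)
    at_nodes (element_energy Num.conj) K (interpolant v))).
  rewrite hform_Ax mulr_sumr; apply: ler_sum => K _.
  by rewrite ler_wpM2r ?energy_ge0 ?lecR.
have -> : (32 / 3 * M)%:C * sqnorm v = M%:C * (32 / 3 * sqnorm v).
  by rewrite !rmorphM fmorphV !rmorph_nat /=; ring.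
rewrite ltr_pM2l ?ltcR //; apply: lt_le_trans (sum_mass_le v); rewrite -sumE ltrDl.
rewrite lt_neqAle sumr_ge0 ?andbT; last by move=> K _; exact: gap_ge0.
apply: contraNneq v0 => /esym /psumr_eq0P H; apply/eqP.
apply: interpolant_eq0; apply: nodal_values_eq0 => //; first exact: interpolant_boundary.
move=> K; have /H/(_ K isT) : forall K, true -> 0 <=
    at_nodes (element_gap Num.conj) K (interpolant v) by move=> K' _; exact: gap_ge0.
exact: element_gap_eq0.
Qed.


End Stiffness.

Lemma barycenter_open (R : realType) n (n0 : (0 < n)%N) (K : triangle n) :
  open_square (barycenter K : R * R).
Proof.
have c0 : 0 < 4 * n%:R * 3 :> R by rewrite !mulr_gt0 ?ltr0n.
have between (x : 'I_n) a b c : (0 < a < 4)%N -> (b <= 4)%N -> (c <= 4)%N ->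
    let y t := (4 * x + t)%:R / (4 * n%:R) : R in
    (y a + y b + y c) / 3 \in `]0, 1[.
  move=> a4 b4 c4 /=; have xn := ltn_ord x.
  rewrite -!mulrDl -mulrA -invfM in_itv /= -!natrD; apply/andP; split.
    by rewrite divr_gt0 // ltr0n; lia.
  by rewrite ltr_pdivrMr // mul1r -!natrM ltr_nat; lia.
have := @nodesE R n n0 K; case: K => [[i j] k] [h0 h1 h2 _].
rewrite /barycenter !sum_ord3 h0 h1 h2 /lattice_node /lattice_point.
by split; rewrite /=; apply: between; case: k {h0 h1 h2} => -[|[|[|[|]]]].
Qed.

(** * The essential range of the symbol *)

Section EssentialRange.
Context {R : realType}.
Implicit Type mu : R * R -> R.
Local Notation C := R[i].
Local Notation "x %:C" := (real_complex R x).
Local Notation msq := (mrestr (@leb2 R) measurable_square).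

Lemma esssup_ge0 mu : bounded_on_square mu ->
  (forall p, square p -> 0 < mu p) -> 0 <= esssup mu.
Proof.
move=> mub mu0; rewrite -lee_fin -ess_sup_fin //.
apply: ess_sup_gee; first exact: msq_gt0.
by apply: ae_square => p /mu0/ltW; rewrite /= lee_fin.
Qed.

Lemma essential_bounds_barycenter n (n0 : (0 < n)%N) mu (K : triangle n) :
  bounded_on_square mu -> midpoint_values_essential n mu ->
  essinf mu <= mu (barycenter K) <= esssup mu.
Proof.
move=> mub mid; have [cK|] := pselect {for barycenter K, continuous mu}; last exact: mid.
apply: essential_bounds_at => //; exact: barycenter_open.
Qed.

Lemma lambda_symbol mu (x t : R * R) (k : 'I_8) : 0 <= mu x ->
  lambda (symbol mu (x, t)) k = mu x * lambda (Ghat t) k.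
Proof. by move=> mu0; rewrite /symbol lambdaZ // Ghat_hermitian. Qed.

Lemma frequencies_nbhs : nbhs ((0, 0) : R * R) (@frequencies R).
Proof.
exists (`]- pi, pi[%classic, `]- pi, pi[%classic).
  by split; apply: near_in_itvoo; rewrite in_itv /= oppr_lt0 pi_gt0.
by move=> [x y] [/= x1 y1]; split; exact: subset_itv_oo_cc.
Qed.

Lemma sign_mode_nbhs (b : bool) (e : R) : 0 < e ->
  nbhs ((0, 0) : R * R) (frequencies `&`
    [set t | `|sign_mode_energy b t - sign_mode_energy b (0, 0)| < e]).
Proof.
by move=> e0; apply: filterI; [exact: frequencies_nbhs|exact: Ghat_mode_near].
Qed.

Lemma square_not_negligible : ~ (@leb2 R).-negligible square.
Proof.
apply: (@nbhs_not_negligible _ (2^-1, 2^-1)).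
apply: filterS (@open_square_sub R) _; apply: open_square_nbhs.
by split; rewrite /= in_itv /=; lra.
Qed.

(** On the whole square [mu] is bounded, so the least eigenvalue of the symbol is
    small for all frequencies near 0. *)
Lemma essential_range_min mu : bounded_on_square mu ->
  (forall p, square p -> 0 < mu p) ->
  essential_range (square `*` frequencies) (symbol mu) 0.
Proof.
move=> [B muB] mu0; exists (@Ordinal 8 7 isT) => e e0.
have B0 : 0 <= B.
  apply: le_trans (muB (0, 0) _) => //.
  by split; rewrite /= in_itv /= lexx ler01.
have d0 : 0 < e / (B + 1) by rewrite divr_gt0 // ltr_wpDl.
move=> neg; apply: (setX_not_negligible square_not_negligible (sign_mode_nbhs false d0)).
apply: negligibleS neg => -[x t] [/= xs [tf]]; rewrite Ghat_mode0 subr0 => te.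
split => //; change (`|lambda (symbol mu (x, t)) (@Ordinal 8 7 isT) - 0| < e).
rewrite subr0 lambda_symbol ?ltW ?mu0 //.
have l0 : 0 <= lambda (Ghat t) 7%N := lambda_min_Ghat_ge0 t.
have le : lambda (Ghat t) 7%N < e / (B + 1).
  apply: le_lt_trans (lambda_min_Ghat_le t) _.
  have := ler_norm (sign_mode_energy false t); have := normr_ge0 (sign_mode_energy false t).
  by lra.
rewrite normrM (ger0_norm l0).
apply: (@le_lt_trans _ _ (B * lambda (Ghat t) 7%N)).
  by rewrite ler_wpM2r // muB.
apply: (@le_lt_trans _ _ (B * (e / (B + 1)))); first by rewrite ler_wpM2l // ltW.
by rewrite mulrA ltr_pdivrMr ?ltr_wpDl // mulrDr mulr1 mulrC ltrDl.
Qed.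

(** The greatest eigenvalue of the symbol is close to [32/3 esssup mu] where
    [mu] is close to its essential supremum and the frequency close to 0. *)
Lemma essential_range_max mu : bounded_on_square mu ->
  (forall p, square p -> 0 < mu p) ->
  essential_range (square `*` frequencies) (symbol mu) (32 / 3 * esssup mu).
Proof.
move=> mub mu0; exists (@Ordinal 8 0 isT) => e e0.
have s0 := esssup_ge0 mub mu0; set s := esssup mu in s0 *.
have d0 : 0 < e / 2 / (s + 1) by rewrite !divr_gt0 // ltr_wpDl.
have c0 : 0 < e * 3 / 64 by rewrite divr_gt0 ?mulr_gt0.
move=> neg.
apply: (setX_not_negligible (esssup_not_negligible mub c0) (sign_mode_nbhs true d0)).
apply: negligibleS neg => -[x t] [/= [xs xe] [tf te]].
split => //; change (`|lambda (symbol mu (x, t)) (@Ordinal 8 0 isT) - 32 / 3 * s| < e).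
rewrite lambda_symbol ?ltW ?mu0 //; rewrite -/s in xe *.
have lM : lambda (Ghat t) 0%N <= 32 / 3 := lambda_max_Ghat_le t.
have l0 : 0 <= lambda (Ghat t) 0%N.
  by have /andP[] := lambda_Ghat_bounds t (@Ordinal 8 0 isT).
have lm : 32 / 3 - e / 2 / (s + 1) < lambda (Ghat t) 0%N.
  apply: lt_le_trans (lambda_max_Ghat_ge t); move: te; rewrite Ghat_mode0 ltr_distl.
  by move=> /andP[te _]; lra.
move: (lambda (Ghat t) 0%N) lM l0 lm => l lM l0 lm.
have -> : mu x * l - 32 / 3 * s = (mu x - s) * l + s * (l - 32 / 3) by ring.
apply: le_lt_trans (ler_normD _ _) _; rewrite !normrM (ger0_norm l0) (ger0_norm s0).
have h1 : `|mu x - s| * l <= e * 3 / 64 * (32 / 3) by rewrite ler_pM // ltW.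
have h2 : s * `|l - 32 / 3| <= s * (e / 2 / (s + 1)).
  by rewrite ler_wpM2l // distrC ger0_norm ?subr_ge0 //; lra.
have h3 : s * (e / 2 / (s + 1)) < e / 2.
  by rewrite mulrA ltr_pdivrMr ?ltr_wpDl // mulrDr mulr1 mulrC ltrDl divr_gt0.
by lra.
Qed.

End EssentialRange.

(** * Both velocity components *)

Section Blocks.
Context {R : realType}.
Local Notation C := R[i].
Local Notation "x %:C" := (real_complex R x).
Variable n : nat.
Hypothesis n0 : (0 < n)%N.
Variable phi : 'I_(ndof n) -> R * R -> R.
Hypothesis phi_basis : nodal_basis phi.
Implicit Types (f g mu : R * R -> R).

Lemma Ax_linear (a : R) f g :
  Ax phi (fun p => a * f p + g p) = a%:C *: Ax phi f + Ax phi g.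
Proof.
apply/matrixP => i j; rewrite [RHS]mxE [X in X + _]mxE !(AxE n0 phi_basis).
rewrite mulr_sumr -big_split; apply: eq_bigr => K _ /=.
by rewrite rmorphD rmorphM mulrDl mulrA.
Qed.

Lemma A_linear (a : R) f g :
  A phi (fun p => a * f p + g p) = a%:C *: A phi f + A phi g.
Proof.
by rewrite /A Ax_linear scale_block_mx add_block_mx !scaler0 !addr0.
Qed.

Lemma A_hermitian mu : A phi mu \is hermsymmx.
Proof.
have /is_hermitianmxP := Ax_hermitian n0 phi_basis mu; rewrite expr0 scale1r => H.
apply/is_hermitianmxP; rewrite expr0 scale1r /A tr_block_mx map_block_mx -H.
by rewrite !trmx0 !map_mx0.
Qed.

Lemma hform_A mu v :
  hform (A phi mu) v = hform (Ax phi mu) (usubmx v) + hform (Ax phi mu) (dsubmx v).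
Proof.
rewrite /hform -{1 2}[v]vsubmxK tr_col_mx map_row_mx mul_row_block !mulmx0 addr0 add0r.
by rewrite mul_row_col mxE.
Qed.

Lemma A_positive f : (forall K : triangle n, 0 <= f (barycenter K)) -> hpsd (A phi f).
Proof.
move=> f0; split; first exact: A_hermitian.
move=> v; rewrite -/(hform _ _) hform_A.
by rewrite addr_ge0 // hform_Ax_ge0.
Qed.

Lemma A_cst (c : R) : A phi (cst c) = c%:C *: A phi (cst 1).
Proof.
apply/eqP; rewrite -subr_eq0; apply/eqP.
have A0 : A phi (cst 0) = 0.
  have := A_linear 1 (cst 0) (cst 0); rewrite (_ : (fun p => _) = cst 0); last first.
    by apply/funext => p /=; rewrite mulr0 addr0.
  by rewrite scale1r => /eqP; rewrite -subr_eq subrr eq_sym => /eqP.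
have := A_linear c (cst 1) (cst 0); rewrite (_ : (fun p => _) = cst c); last first.
  by apply/funext => p /=; rewrite mulr1 addr0.
by move=> ->; rewrite A0 addr0 subrr.
Qed.

Lemma lambda_A_cst (c : R) (j : 'I_(ndof n + ndof n)) : 0 <= c ->
  lambda (A phi (cst c)) j = c * lambda (A phi (cst 1)) j.
Proof. by move=> c0; rewrite A_cst lambdaZ // A_hermitian. Qed.

Lemma le_lambda_A f g (j : 'I_(ndof n + ndof n)) :
  (forall K : triangle n, f (barycenter K) <= g (barycenter K)) ->
  lambda (A phi f) j <= lambda (A phi g) j.
Proof.
move=> fg; apply: le_lambda; [exact: A_hermitian..|move=> v].
by rewrite !hform_A lerD // le_hform_Ax.
Qed.

Lemma lambda_Ax_bounds mu (M : R) (j : 'I_(ndof n)) : 0 < M ->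
  (forall K : triangle n, 0 < mu (barycenter K) <= M) ->
  0 < lambda (Ax phi mu) j < 32 / 3 * M.
Proof.
move=> M0 muM; have [v v0 Av] := lambda_eigenvector j (Ax_hermitian n0 phi_basis mu).
have v_gt0 := sqnorm_gt0 v0.
have mu0 K : 0 < mu (barycenter (K : triangle n)) by have /andP[] := muM K.
have muM' K : mu (barycenter (K : triangle n)) <= M by have /andP[] := muM K.
have := hform_Ax_gt0 n0 phi_basis mu0 v0.
have := hform_Ax_lt n0 phi_basis M0 muM' v0.
rewrite (hform_eigen Av) ltr_pM2r // pmulr_lgt0 // ltcR => ->.
by rewrite andbT ltcE /= eqxx.
Qed.

End Blocks.

Theorem mainTheorem3 (R : realType)
    (phi : forall n : nat, 'I_(ndof n) -> R * R -> R)
    (hphi : forall n : nat, (0 < n)%N -> nodal_basis (phi n))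
    (mu : R * R -> R)
    (hmu : riemann_integrable mu)
    (mu_gt0 : forall p, square p -> 0 < mu p) :
  [/\ (* linear positive operator *)
      forall n : nat, (0 < n)%N -> linear_positive_operator (A (phi n)),
      (* monotonicity *)
      forall n : nat, (0 < n)%N -> forall f g : R * R -> R,
        (forall p, square p -> f p <= g p) ->
        loewner_le (A (phi n) f) (A (phi n) g),
      (* bounds by the constant-viscosity matrices *)
      forall n : nat, (0 < n)%N -> forall j : 'I_(ndof n + ndof n),
        [/\ lambda (A (phi n) (cst (essinf mu))) j
              = essinf mu * lambda (A (phi n) (cst 1)) j,
            lambda (A (phi n) (cst (esssup mu))) j
              = esssup mu * lambda (A (phi n) (cst 1)) j
          & midpoint_values_essential n mu ->
            lambda (A (phi n) (cst (essinf mu))) j <= lambda (A (phi n) mu) j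
              <= lambda (A (phi n) (cst (esssup mu))) j]
    & (* localization by the symbol and absence of outliers *)
      exists m M : R,
        [/\ is_min [set lambda_min (Ghat t) | t in frequencies] m,
            is_max [set lambda_max (Ghat t) | t in frequencies] M
          & forall n : nat, (0 < n)%N -> midpoint_values_essential n mu ->
            forall j : 'I_(ndof n),
              m * essinf mu < lambda (Ax (phi n) mu) j < M * esssup mu /\
              exists a b : R,
                [/\ essential_range (square `*` frequencies) (symbol mu) a,
                    essential_range (square `*` frequencies) (symbol mu) b
                  & a < lambda (Ax (phi n) mu) j < b]]].
Proof.
have mub : bounded_on_square mu by case: hmu.
have bary_square n (n0 : (0 < n)%N) (K : triangle n) : square (barycenter K : R * R).
  by apply: open_square_sub; exact: barycenter_open.
split.
- move=> n n0; split; first exact: A_linear (hphi n n0).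
  by move=> f f0; apply: A_positive (hphi n n0) _ _ => // K; exact/f0/bary_square.
- move=> n n0 f g fg; rewrite /loewner_le.
  have -> : A (phi n) g - A (phi n) f = A (phi n) (fun p => -1 * f p + g p).
    by rewrite (A_linear n0 (hphi n n0)) rmorphN1 scaleN1r addrC.
  apply: A_positive (hphi n n0) _ _ => // K.
  by rewrite mulN1r addrC subr_ge0; exact/fg/bary_square.
- move=> n n0 j; split.
  + by apply: (lambda_A_cst n0 (hphi n n0)); exact: essinf_ge0.
  + by apply: (lambda_A_cst n0 (hphi n n0)); exact: esssup_ge0.
  + move=> mid; apply/andP; split; apply: (le_lambda_A n0 (hphi n n0)) => K;
    by have /andP[] := essential_bounds_barycenter n0 K mub mid.
- exists 0, (32 / 3).
  have f0 : frequencies ((0, 0) : R * R) by exact: (nbhs_singleton frequencies_nbhs).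
  split.
  + split; first by exists (0, 0); rewrite ?lambda_min_Ghat0.
    by move=> _ [t _ <-]; exact: lambda_min_Ghat_ge0.
  + split; first by exists (0, 0); rewrite ?lambda_max_Ghat0.
    by move=> _ [t _ <-]; exact: lambda_max_Ghat_le.
  + move=> n n0 mid j.
    have ess K := essential_bounds_barycenter n0 K mub mid.
    have esup0 : 0 < esssup mu.
      have /andP[_] := ess (Ordinal n0, Ordinal n0, ord0).
      by apply: lt_le_trans; exact/mu_gt0/bary_square.
    have lam : 0 < lambda (Ax (phi n) mu) j < 32 / 3 * esssup mu.
      apply: (lambda_Ax_bounds n0 (hphi n n0)) => // K.
      rewrite mu_gt0 /=; last exact: bary_square.
      by have /andP[] := ess K.
    rewrite mul0r; split => //; exists 0, (32 / 3 * esssup mu); split => //.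
      exact: essential_range_min.
    exact: essential_range_max.
Qed.
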